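(* For $m\in\mathbb{N}=\{1,2,\dots\}$ write $$\Sigma_m=\sum_{k=0}^{m-1}(-1)^k\binom{2m}{k}(m-k)^{2m-1}+2\sum_{k=1}^{m-1}(-1)^k\sum_{\ell=0}^{m-k-1}(-1)^{\ell}\binom{2m}{\ell}(m-k-\ell)^{2m-1}$$ and $$\Lambda_m=\sum_{\ell=1}^{2m}(-1)^\ell\frac1{2^\ell}\Bigl(\frac1\ell-\frac1{2m+1}\Bigr)\binom{2m+1}{\ell}\sum_{q=0}^\ell\binom{\ell}{q}(2q-\ell)^{2m}.$$ Then for every $m\in\mathbb{N}$ the following hold. (i) The Bernoulli numbers satisfy $$B_{2m}=(-1)^{m-1}\frac{m}{2^{2m-1}(2^{2m}-1)}\,\Sigma_m,\qquad B_{2m}=-\frac{m}{2^{2m-1}(2^{2m}-1)}\,\Lambda_m,$$ and the sequence $\mathcal{B}_{2m}=\frac{2^{2m}-1}{2m}B_{2m}$ satisfies $$\mathcal{B}_{2(m+1)}=-\sum_{k=1}^m\binom{2m}{2k-1}\mathcal{B}_{2k}\mathcal{B}_{2(m-k+1)}.$$ (ii) The values of the Riemann zeta function at even positive integers satisfy $$\zeta(2m)=\frac{\pi^{2m}m}{(2m)!(2^{2m}-1)}\,\Sigma_m,\qquad \zeta(2m)=(-1)^m\frac{\pi^{2m}m}{(2m)!(2^{2m}-1)}\,\Lambda_m,$$ and the sequence $\mathcal{Z}_{2m}=(-1)^m\frac{(2m)!(2^{2m}-1)}{(2\pi)^{2m}m}\zeta(2m)$ satisfies $$\mathcal{Z}_{2(m+1)}=\sum_{k=1}^m\binom{2m}{2k-1}\mathcal{Z}_{2k}\mathcal{Z}_{2(m-k+1)}.$$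 (iii) The Genocchi numbers satisfy $$G_{2m}=(-1)^m\frac{m}{2^{2(m-1)}}\,\Sigma_m,\qquad G_{2m}=\frac{2m}{2^{2m-1}}\,\Lambda_m,$$ and the sequence $\mathcal{G}_{2m}=\frac1m G_{2m}$ satisfies $$\mathcal{G}_{2(m+1)}=\frac14\sum_{k=1}^m\binom{2m}{2k-1}\mathcal{G}_{2k}\mathcal{G}_{2(m-k+1)}.$$ (iv) The values of the Euler polynomials at $0$ satisfy $$E_{2m-1}(0)=(-1)^m\frac1{2^{2m-1}}\,\Sigma_m,\qquad E_{2m-1}(0)=\frac1{2^{2m-1}}\,\Lambda_m,$$ and $$E_{2m+1}(0)=\frac12\sum_{k=1}^m\binom{2m}{2k-1}E_{2k-1}(0)E_{2(m-k)+1}(0).$$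
   Context: The Bernoulli numbers $B_n$, $n\ge0$, are defined by $\frac{x}{e^x-1}=\sum_{n=0}^\infty B_n\frac{x^n}{n!}$ for $|x|<2\pi$. The Riemann zeta function is $\zeta(s)=\sum_{k=1}^\infty\frac1{k^s}$ for $\Re(s)>1$. The Genocchi numbers $G_k$ are defined by $\frac{2z}{e^z+1}=\sum_{k=1}^\infty G_k\frac{z^k}{k!}$ for $|z|<\pi$. The Euler polynomials $E_k(x)$ are defined by $\frac{2e^{xz}}{e^z+1}=\sum_{k=0}^\infty E_k(x)\frac{z^k}{k!}$ for $|z|<\pi$. Empty sums are $0$. *)

(* Defs.v *)
From Stdlib Require Import Reals Factorial.
From Coquelicot Require Import Coquelicot.
Open Scope R_scope.

(** Throughout, [sum_n_m a p q] is [a p + ... + a q], and is [0] when [q < p].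
    Binomial coefficients are [Binomial.C]; they are only used as
    [Binomial.C n k] with [k <= n], outside of which [Binomial.C] is not [0]. *)

(** The generating functions are taken in a real variable, which already
    determines the coefficients.  The singularity of [x / (exp x - 1)] at [0]
    is removable, hence [x <> 0]. *)
Definition is_bernoulli (B : nat -> R) : Prop :=
  forall x : R, x <> 0 -> Rabs x < 2 * PI ->
    is_series (fun n : nat => B n * (x ^ n / INR (fact n))) (x / (exp x - 1)).

(** The series starts at the index [1], so [G 0] is irrelevant. *)
Definition is_genocchi (G : nat -> R) : Prop :=
  forall z : R, Rabs z < PI ->
    is_series (fun n : nat => G (S n) * (z ^ (S n) / INR (fact (S n))))
              (2 * z / (exp z + 1)).

Definition is_euler_polynomials (E : nat -> R -> R) : Prop :=
  forall x z : R, Rabs z < PI ->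
    is_series (fun k : nat => E k x * (z ^ k / INR (fact k)))
              (2 * exp (x * z) / (exp z + 1)).

(** Meaningful for [1 < s] only: [Series] is total. *)
Definition zeta (s : R) : R :=
  Series (fun k : nat => 1 / Rpower (INR (S k)) s).

Definition Sigma (m : nat) : R :=
  sum_n_m (fun k : nat =>
      (-1) ^ k * Binomial.C (2 * m) k * (INR m - INR k) ^ (2 * m - 1))
    0 (m - 1)
  + 2 * sum_n_m (fun k : nat =>
      (-1) ^ k *
      sum_n_m (fun l : nat =>
          (-1) ^ l * Binomial.C (2 * m) l
          * (INR m - INR k - INR l) ^ (2 * m - 1))
        0 (m - k - 1))
    1 (m - 1).

Definition Lambda (m : nat) : R :=
  sum_n_m (fun l : nat =>
      (-1) ^ l * (1 / 2 ^ l) * (1 / INR l - 1 / INR (2 * m + 1))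
      * Binomial.C (2 * m + 1) l
      * sum_n_m (fun q : nat =>
            Binomial.C l q * (2 * INR q - INR l) ^ (2 * m))
          0 l)
    1 (2 * m).

(** In the next three definitions the argument [m] stands for the even
    index [2m]. *)
Definition calB (B : nat -> R) (m : nat) : R :=
  (2 ^ (2 * m) - 1) / INR (2 * m) * B (2 * m)%nat.

Definition calZ (m : nat) : R :=
  (-1) ^ m
  * (INR (fact (2 * m)) * (2 ^ (2 * m) - 1) / ((2 * PI) ^ (2 * m) * INR m))
  * zeta (INR (2 * m)).

Definition calG (G : nat -> R) (m : nat) : R :=
  1 / INR m * G (2 * m)%nat.

(* Main.v *)
Require Import Defs.
From Stdlib Require Import Reals Factorial Lra Lia FunctionalExtensionality.
From Coquelicot Require Import Coquelicot.
Open Scope R_scope.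

(** Everything is expressed through the numbers [x_m = E_(2m-1)(0)], the odd
    coefficients of [f = 2 / (exp z + 1)], handled as a formal exponential
    generating series.  The Riccati equation [2 g' = g^2 - 1] for [g = f - 1]
    gives the quadratic recursion.  For [Lambda], truncate
    [ln cosh = - sum (1 - cosh)^j / j] : the error has high order at [0].  For
    [Sigma], whose inner sums are Eulerian numbers, use
    [(1 + e) h = 2^N + e (1 - e)^N] where [h = sum_(j <= N) sum_(l <= j) C(N,l) (-e)^(j-l)]
    and [e = exp z], so that [h] and [2^(N-1) f] agree below order [N = 2m].
    For zeta, put [lam p = sum_(t odd) 1 / t^p]; summing a geometric
    progression in [sum_k 1 / (s^(2k) t^(2(m-k+1)))] and telescoping
    [sum_(t <> s) 1 / (t^2 - s^2) = 1 / (4 s^2)] yields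
    [sum_k lam(2k) lam(2(m-k+1)) = (m + 1/2) lam(2m+2)], which is the same
    quadratic recursion; the initial value [lam 2 = PI^2 / 8] comes from
    iterating the duplication formula for [1 / sin^2]. *)

(** Put [x_m = heuler (2 * m - 1)]. The sequences [calB], [calZ], [calG] and the Euler values are
    [c * x_m] with [c = -1/2, 1/2, 2, 1] respectively. Rescaling by [c] turns the coefficient [1/2]
    of the recursion for [x_m] into [1/(2c)], hence the coefficients [-1, 1, 1/4, 1/2] of the
    statement. Both closed forms come from identities that hold only below a certain order in [z].
    Formal series suit this: such an identity may be divided by any series with nonzero constant
    term, without any question of convergence. The exponential normalization makes differentiation a
    shift and [exp (c z)] the sequence [c ^ n]. Zeta values are not given as coefficients of a
    series, so they are identified through uniqueness of the solution of the recursion. The double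
    sum over pairs of odd integers is cut to a square [i, j <= N], so that every exchange of sums is
    finite; the price is an explicit error, at most of order [log N / N]. *)

(* Coquelicot's sums live in [R_AbelianMonoid], which [ring] and [field] do not
   recognize as [R]. *)
Ltac real_eq := match goal with |- ?a = ?b => change (@eq R a b) end.

Ltac real_ring :=
  try change (@plus R_AbelianMonoid) with Rplus;
  try change (@mult R_Ring) with Rmult; real_eq; ring.

(** * Finite sums *)

Lemma sum_n_m_Rmult_l (c : R) (u : nat -> R) (p q : nat) :
  sum_n_m (fun k => c * u k) p q = c * sum_n_m u p q.
Proof. exact (sum_n_m_mult_l (K := R_Ring) c u p q). Qed.

Lemma sum_n_Rmult_l (c : R) (u : nat -> R) (n : nat) :
  sum_n (fun k => c * u k) n = c * sum_n u n.
Proof. exact (sum_n_mult_l (K := R_Ring) c u n). Qed.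

Lemma sum_n_Rplus (u v : nat -> R) (n : nat) :
  sum_n (fun k => u k + v k) n = sum_n u n + sum_n v n.
Proof. exact (sum_n_plus (G := R_AbelianMonoid) u v n). Qed.

Lemma sum_n_rev (u : nat -> R) (n : nat) :
  sum_n (fun k => u (n - k)%nat) n = sum_n u n.
Proof.
  revert u; induction n as [|n IH]; intro u; [rewrite !sum_O; reflexivity|].
  rewrite (sum_Sn u n), sum_Sn, Nat.sub_diag.
  rewrite (sum_n_ext_loc _ (fun k => u (S (n - k)))).
  2:{ intros k Hk; f_equal; lia. }
  rewrite (IH (fun k => u (S k))).
  transitivity (sum_n u (S n)); [|apply sum_Sn].
  unfold sum_n; rewrite (sum_Sn_m u 0 (S n)) by lia.
  rewrite sum_n_m_S; apply Rplus_comm.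
Qed.

Lemma sum_n_m_from_1 (u : nat -> R) (M : nat) : (1 <= M)%nat ->
  sum_n_m u 1 M = sum_n (fun j => u (S j)) (M - 1).
Proof.
  intro HM; unfold sum_n; rewrite sum_n_m_S.
  f_equal; lia.
Qed.

Lemma sum_n_m_from (u : nat -> R) (p q : nat) : (p <= q)%nat ->
  sum_n_m u p q = sum_n (fun k => u (p + k)%nat) (q - p).
Proof.
  intro H; replace q with (p + (q - p))%nat at 1 by lia.
  generalize (q - p)%nat; intro d; induction d as [|d IH].
  - rewrite Nat.add_0_r, sum_n_n, sum_O, Nat.add_0_r; reflexivity.
  - rewrite Nat.add_succ_r, sum_n_Sm, sum_Sn, IH, Nat.add_succ_r by lia; reflexivity.
Qed.

(** Folds the alternating sum of Eulerian numbers about its middle index, which is the shape of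
    [Sigma]. *)
Lemma sum_n_symmetric (u : nat -> R) (m : nat) :
  (forall j, (j <= 2 * m)%nat -> u (2 * m - j)%nat = u j) ->
  sum_n u (2 * m) = u m + 2 * sum_n_m (fun k => u (m - k)%nat) 1 m.
Proof.
  intro Hu.
  (* The window [m - k .. m + k] grows by one term at each end. *)
  assert (H : forall k, (k <= m)%nat -> sum_n_m u (m - k) (m + k)
    = u m + 2 * sum_n_m (fun i => u (m - i)%nat) 1 k).
  { induction k as [|k IH]; intro Hk.
    - rewrite Nat.sub_0_r, Nat.add_0_r, sum_n_n, sum_n_m_zero by lia.
      unfold zero; simpl; ring.
    - rewrite sum_Sn_m by lia.
      replace (S (m - S k)) with (m - k)%nat by lia.
      replace (m + S k)%nat with (S (m + k)) by lia.
      rewrite sum_n_Sm, IH by lia.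
      rewrite sum_n_Sm by lia.
      replace (S (m + k)) with (2 * m - (m - S k))%nat by lia.
      rewrite Hu by lia.
      unfold plus; simpl; ring. }
  rewrite <- (H m) by lia.
  unfold sum_n; f_equal; lia.
Qed.

Lemma sum_n_odd (u : nat -> R) (m : nat) :
  (forall j, (j <= m)%nat -> u (2 * j)%nat = 0) ->
  sum_n u (2 * m) = sum_n_m (fun k => u (2 * k - 1)%nat) 1 m.
Proof.
  induction m as [|m IH]; intro Hu.
  - simpl; rewrite sum_O, sum_n_m_zero by lia; apply (Hu O); lia.
  - replace (2 * S m)%nat with (S (S (2 * m))) at 1 by lia.
    rewrite !sum_Sn, IH, sum_n_Sm by (trivial; try lia; intros; apply Hu; lia).
    replace (S (S (2 * m))) with (2 * S m)%nat by lia.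
    rewrite (Hu (S m)) by lia.
    replace (2 * S m - 1)%nat with (S (2 * m)) by lia.
    unfold plus; simpl; ring.
Qed.

(** * Formal exponential generating series *)

(* The series with terms [a n * z ^ n / n!]: [hshift] is the derivative, and the
   product is defined by the Leibniz rule, which makes the ring laws immediate
   inductions. *)
Definition hseries := nat -> R.

Definition hshift (a : hseries) : hseries := fun n => a (S n).
Definition hconst (r : R) : hseries := fun n => match n with O => r | S _ => 0 end.
Definition hadd (a b : hseries) : hseries := fun n => a n + b n.
Definition hopp (a : hseries) : hseries := fun n => - a n.
Definition hsub (a b : hseries) : hseries := fun n => a n - b n.

Fixpoint hmul_coef (n : nat) (a b : hseries) : R :=
  match n with
  | O => a O * b O
  | S p => hmul_coef p (hshift a) b + hmul_coef p a (hshift b)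
  end.

Definition hmul (a b : hseries) : hseries := fun n => hmul_coef n a b.

Declare Scope hseries_scope.
Delimit Scope hseries_scope with H.
Bind Scope hseries_scope with hseries.
Infix "+" := hadd : hseries_scope.
Infix "-" := hsub : hseries_scope.
Infix "*" := hmul : hseries_scope.
Notation "- a" := (hopp a) : hseries_scope.

Lemma hshift_mul (a b : hseries) :
  hshift (a * b)%H = (hshift a * b + a * hshift b)%H.
Proof. reflexivity. Qed.

Lemma hmul_comm (a b : hseries) : (a * b = b * a)%H.
Proof.
  apply functional_extensionality; intro n; revert a b.
  induction n as [|n IH]; intros a b; unfold hmul; simpl; [ring|].
  rewrite (IH (hshift a) b : hmul_coef n _ _ = hmul_coef n _ _).
  rewrite (IH a (hshift b) : hmul_coef n _ _ = hmul_coef n _ _).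
  ring.
Qed.

Lemma hmul_add_l (a b c : hseries) : ((a + b) * c = a * c + b * c)%H.
Proof.
  apply functional_extensionality; intro n; revert a b c.
  induction n as [|n IH]; intros a b c; [cbv; ring|].
  change (hmul_coef n (hshift a + hshift b)%H c + hmul_coef n (a + b)%H (hshift c)
    = hmul_coef (S n) a c + hmul_coef (S n) b c).
  pose proof (IH (hshift a) (hshift b) c) as H1.
  pose proof (IH a b (hshift c)) as H2.
  unfold hmul, hadd at 2 in H1; unfold hmul, hadd at 2 in H2.
  rewrite H1, H2; simpl; ring.
Qed.

Lemma hmul_assoc (a b c : hseries) : (a * (b * c) = (a * b) * c)%H.
Proof.
  apply functional_extensionality; intro n; revert a b c.
  induction n as [|n IH]; intros a b c; [cbv; ring|].
  change ((hshift a * (b * c))%H n + (a * hshift (b * c))%H n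
    = (hshift (a * b) * c)%H n + ((a * b) * hshift c)%H n).
  rewrite !hshift_mul, (hmul_comm a (_ + _)%H), !hmul_add_l.
  unfold hadd.
  rewrite !IH, (hmul_comm (hshift b * c)%H a), (hmul_comm (b * hshift c)%H a), !IH.
  ring.
Qed.

Lemma hmul_zero_l (a : hseries) : (hconst 0 * a = hconst 0)%H.
Proof.
  apply functional_extensionality; intro n; revert a.
  induction n as [|n IH]; intros a; [cbv; ring|].
  change ((hshift (hconst 0) * a)%H n + (hconst 0 * hshift a)%H n = 0).
  replace (hshift (hconst 0)) with (hconst 0)
    by (apply functional_extensionality; intros [|k]; reflexivity).
  rewrite !IH; destruct n; simpl; ring.
Qed.

Lemma hmul_const_l (r : R) (a : hseries) (n : nat) :
  (hconst r * a)%H n = r * a n.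
Proof.
  revert a; induction n as [|n IH]; intros a; [reflexivity|].
  change ((hshift (hconst r) * a)%H n + (hconst r * hshift a)%H n = r * a (S n)).
  replace (hshift (hconst r)) with (hconst 0)
    by (apply functional_extensionality; intros [|k]; reflexivity).
  rewrite hmul_zero_l, IH; destruct n; unfold hshift; simpl; ring.
Qed.

Lemma hseries_ring :
  ring_theory (hconst 0) (hconst 1) hadd hmul hsub hopp (@eq hseries).
Proof.
  constructor.
  - intro a; apply functional_extensionality; intros [|n]; cbv; ring.
  - intros a b; apply functional_extensionality; intros n; cbv; ring.
  - intros a b c; apply functional_extensionality; intros n; cbv; ring.
  - intro a; apply functional_extensionality; intro n; rewrite hmul_const_l; ring.
  - exact hmul_comm.
  - exact hmul_assoc.
  - exact hmul_add_l.
  - intros a b; apply functional_extensionality; intros n; cbv; ring.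
  - intro a; apply functional_extensionality; intros [|n]; cbv; ring.
Qed.

Add Ring hseries_ring_instance : hseries_ring.

Fixpoint hpow (a : hseries) (k : nat) : hseries :=
  match k with O => hconst 1 | S p => (a * hpow a p)%H end.
Infix "^" := hpow : hseries_scope.

Lemma hconst_mul (r s : R) : hconst (r * s) = (hconst r * hconst s)%H.
Proof.
  apply functional_extensionality; intro n; rewrite hmul_const_l.
  destruct n; simpl; ring.
Qed.

Lemma hconst_add (r s : R) : hconst (r + s) = (hconst r + hconst s)%H.
Proof. apply functional_extensionality; intros [|n]; cbv; ring. Qed.

Lemma hconst_pow (r : R) (k : nat) : hconst (r ^ k) = (hconst r ^ k)%H.
Proof.
  induction k as [|k IH]; [reflexivity|].
  simpl; rewrite hconst_mul, IH; reflexivity.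
Qed.

Lemma hpow_mul (a b : hseries) (k : nat) : ((a * b) ^ k = a ^ k * b ^ k)%H.
Proof. induction k as [|k IH]; simpl; [|rewrite IH]; ring. Qed.

Lemma hshift_add (a b : hseries) : hshift (a + b)%H = (hshift a + hshift b)%H.
Proof. reflexivity. Qed.

Lemma hshift_const (r : R) : hshift (hconst r) = hconst 0.
Proof. apply functional_extensionality; intros [|n]; reflexivity. Qed.

Lemma hshift_pow (a : hseries) (k : nat) :
  hshift (a ^ S k)%H = (hconst (INR (S k)) * a ^ k * hshift a)%H.
Proof.
  induction k as [|k IH].
  - simpl; rewrite hshift_mul, hshift_const; simpl; ring.
  - change (a ^ S (S k))%H with (a * a ^ S k)%H.
    rewrite hshift_mul, IH, (S_INR (S k)), hconst_add; simpl; ring.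
Qed.

Definition hexp (c : R) : hseries := fun n => c ^ n.

Lemma hshift_exp (c : R) : hshift (hexp c) = (hconst c * hexp c)%H.
Proof. apply functional_extensionality; intro n; rewrite hmul_const_l; reflexivity. Qed.

Lemma hexp_add (c d : R) : hexp (c + d) = (hexp c * hexp d)%H.
Proof.
  apply functional_extensionality; intro n.
  induction n as [|n IH]; [cbv; ring|].
  change (hexp (c + d) (S n))
    with ((c + d) * hexp (c + d) n).
  change ((c + d) * hexp (c + d) n
    = (hshift (hexp c) * hexp d)%H n + (hexp c * hshift (hexp d))%H n).
  rewrite !hshift_exp.
  replace (hconst c * hexp c * hexp d)%H
    with (hconst c * (hexp c * hexp d))%H by ring.
  replace (hexp c * (hconst d * hexp d))%H
    with (hconst d * (hexp c * hexp d))%H by ring.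
  rewrite !hmul_const_l, IH; ring.
Qed.

Lemma hexp_0 : hexp 0 = hconst 1.
Proof. apply functional_extensionality; intros [|n]; cbv; ring. Qed.

Lemma hexp_pow (c : R) (k : nat) : (hexp c ^ k)%H = hexp (INR k * c).
Proof.
  induction k as [|k IH].
  - rewrite Rmult_0_l, hexp_0; reflexivity.
  - rewrite S_INR, Rmult_plus_distr_r, Rmult_1_l, hexp_add, <- IH; simpl; ring.
Qed.

(** Substitution of [c * z] for [z]; used with [c = 2] to relate [exp z] and [exp (2 * z)]. *)
Definition hdil (c : R) (a : hseries) : hseries := fun n => c ^ n * a n.

Lemma hdil_mul (c : R) (a b : hseries) : hdil c (a * b)%H = (hdil c a * hdil c b)%H.
Proof.
  (* Chain rule. *)
  assert (Hs : forall u, hshift (hdil c u) = (hconst c * hdil c (hshift u))%H).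
  { intro u; apply functional_extensionality; intro n; rewrite hmul_const_l.
    unfold hshift, hdil; simpl; ring. }
  apply functional_extensionality; intro n; revert a b.
  induction n as [|n IH]; intros a b; [cbv; ring|].
  change (hdil c (a * b)%H (S n)) with
    (c * c ^ n * ((hshift a * b)%H n + (a * hshift b)%H n)).
  change ((hdil c a * hdil c b)%H (S n)) with
    ((hshift (hdil c a) * hdil c b)%H n + (hdil c a * hshift (hdil c b))%H n).
  rewrite !Hs, <- hmul_assoc.
  replace (hdil c a * (hconst c * hdil c (hshift b)))%H
    with (hconst c * (hdil c a * hdil c (hshift b)))%H by ring.
  rewrite !hmul_const_l, <- !IH; unfold hdil; ring.
Qed.

(** * Order of vanishing and cancellation *)

Lemma hmul_vanish (a b : hseries) (p q : nat) :
  (forall n, (n < p)%nat -> a n = 0) -> (forall n, (n < q)%nat -> b n = 0) ->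
  forall n, (n < p + q)%nat -> (a * b)%H n = 0.
Proof.
  intros Ha Hb n; revert a b p q Ha Hb.
  induction n as [|n IH]; intros a b p q Ha Hb Hn.
  - change (a O * b O = 0).
    destruct p; [rewrite (Hb O) by lia | rewrite (Ha O) by lia]; ring.
  - change ((hshift a * b)%H n + (a * hshift b)%H n = 0).
    (* Differentiating a factor lowers its order of vanishing by one; [pred] also covers order [0],
       where nothing is claimed about the factor. *)
    rewrite (IH (hshift a) b (pred p) q), (IH a (hshift b) p (pred q));
      try assumption; try lia; try ring.
    + intros k Hk; apply Hb; lia.
    + intros k Hk; apply Ha; lia.
Qed.

Lemma hpow_vanish (a : hseries) (k : nat) :
  a O = 0 -> forall n, (n < k)%nat -> (a ^ k)%H n = 0.
Proof.
  intro Ha; induction k as [|k IH]; intros n Hn; [lia|].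
  apply (hmul_vanish a (a ^ k)%H 1 k); trivial.
  intros [|j] Hj; [assumption | lia].
Qed.

Lemma hmul_lead (a b : hseries) (p : nat) :
  (forall n, (n < p)%nat -> b n = 0) -> (a * b)%H p = a O * b p.
Proof.
  revert a b; induction p as [|p IH]; intros a b Hb; [reflexivity|].
  change ((hshift a * b)%H p + (a * hshift b)%H p = a O * b (S p)).
  rewrite (hmul_vanish (hshift a) b 0 (S p)) by (trivial; intros; lia).
  rewrite IH; [unfold hshift; ring|].
  intros n Hn; apply Hb; lia.
Qed.

(** The first nonzero coefficient of [b] would reappear in [a * b], multiplied by [a 0]. This is the
    division step for identities known only below order [N]; both closed forms end with it, dividing
    by [cosh] or by [1 + exp]. *)
Lemma hmul_cancel_vanish (a b : hseries) (N : nat) :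
  a O <> 0 -> (forall n, (n < N)%nat -> (a * b)%H n = 0) ->
  forall n, (n < N)%nat -> b n = 0.
Proof.
  intros Ha H n; induction n as [n IH] using Wf_nat.lt_wf_ind; intro Hn.
  assert (E : a O * b n = 0).
  { rewrite <- (hmul_lead a b n); [apply H; lia|].
    intros k Hk; apply IH; lia. }
  apply Rmult_integral in E; destruct E; [contradiction | assumption].
Qed.

Lemma hmul_cancel (a b c : hseries) :
  a O <> 0 -> (a * b = a * c)%H -> b = c.
Proof.
  intros Ha H; apply functional_extensionality; intro n.
  assert (E : (b - c)%H n = 0).
  { apply (hmul_cancel_vanish a (b - c)%H (S n) Ha); [|lia].
    intros k _; replace (a * (b - c))%H with (a * b - a * c)%H by ring.
    rewrite H; cbv; ring. }
  unfold hsub in E; lra.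
Qed.

Definition hsum (u : nat -> hseries) (N : nat) : hseries :=
  fun n => sum_n (fun k => u k n) N.

Lemma hsum_O (u : nat -> hseries) : hsum u 0 = u O.
Proof. apply functional_extensionality; intro n.
  exact (sum_O (fun k => u k n)). Qed.

Lemma hsum_S (u : nat -> hseries) (N : nat) : hsum u (S N) = (hsum u N + u (S N))%H.
Proof. apply functional_extensionality; intro n.
  exact (sum_Sn (fun k => u k n) N). Qed.

Lemma hsum_ext (u v : nat -> hseries) (N : nat) :
  (forall k, (k <= N)%nat -> u k = v k) -> hsum u N = hsum v N.
Proof.
  intro H; apply functional_extensionality; intro n.
  apply sum_n_ext_loc; intros k Hk; rewrite H; trivial.
Qed.

Lemma hsum_mul_l (a : hseries) (u : nat -> hseries) (N : nat) :
  (a * hsum u N)%H = hsum (fun k => a * u k)%H N.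
Proof.
  induction N as [|N IH]; [rewrite !hsum_O; reflexivity|].
  rewrite !hsum_S, <- IH; ring.
Qed.

Lemma hshift_sum (u : nat -> hseries) (N : nat) :
  hshift (hsum u N) = hsum (fun k => hshift (u k)) N.
Proof. reflexivity. Qed.

(** * Pascal's rule, the binomial theorem and the Leibniz formula *)

Lemma C_n_0 (n : nat) : Binomial.C n 0 = 1.
Proof.
  unfold Binomial.C; rewrite Nat.sub_0_r; simpl.
  field; apply INR_fact_neq_0.
Qed.

Lemma C_n_n (n : nat) : Binomial.C n n = 1.
Proof.
  unfold Binomial.C; rewrite Nat.sub_diag; simpl.
  field; apply INR_fact_neq_0.
Qed.

(* Junk values: [Binomial.C n (S n)] is not [0], hence the top terms are peeled off. *)
Lemma sum_pascal (u : nat -> R) (n : nat) :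
  sum_n (fun k => Binomial.C (S n) k * u k) (S n)
  = sum_n (fun k => Binomial.C n k * (u k + u (S k))) n.
Proof.
  assert (H : forall p, (p <= n)%nat ->
    sum_n (fun k => Binomial.C (S n) k * u k) p + Binomial.C n p * u (S p)
    = sum_n (fun k => Binomial.C n k * (u k + u (S k))) p).
  { induction p as [|p IH]; intro Hp.
    - rewrite !sum_O, !C_n_0; ring.
    - rewrite !sum_Sn, <- IH by lia; unfold plus; simpl.
      rewrite <- (pascal n p) by lia; ring. }
  rewrite sum_Sn, <- (H n) by lia; unfold plus; simpl.
  rewrite !C_n_n; ring.
Qed.

Lemma hpow_one_add (a : hseries) (N : nat) :
  ((hconst 1 + a) ^ N = hsum (fun l => hconst (Binomial.C N l) * a ^ l) N)%H.
Proof.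
  induction N as [|N IH].
  - rewrite hsum_O, C_n_0; simpl; ring.
  - change ((hconst 1 + a) ^ S N)%H with ((hconst 1 + a) * (hconst 1 + a) ^ N)%H.
    rewrite IH, hsum_mul_l.
    apply functional_extensionality; intro n.
    transitivity (sum_n (fun l => Binomial.C (S N) l * (a ^ l)%H n) (S N)).
    2:{ apply sum_n_ext; intro k; rewrite hmul_const_l; reflexivity. }
    rewrite sum_pascal; apply sum_n_ext; intro k.
    replace ((hconst 1 + a) * (hconst (Binomial.C N k) * a ^ k))%H
      with (hconst (Binomial.C N k) * (a ^ k + a ^ S k))%H by (simpl; ring).
    rewrite hmul_const_l; reflexivity.
Qed.

(** Links the recursive product to the Cauchy product of convergent series, and is the source of the
    binomial coefficients in the recursion. *)
Lemma hmul_coef_sum (a b : hseries) (n : nat) :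
  (a * b)%H n = sum_n (fun k => Binomial.C n k * (a k * b (n - k)%nat)) n.
Proof.
  revert a b; induction n as [|n IH]; intros a b.
  - rewrite sum_O, C_n_0; simpl; unfold hmul; simpl; ring.
  - change ((hshift a * b)%H n + (a * hshift b)%H n
      = sum_n (fun k => Binomial.C (S n) k * (a k * b (S n - k)%nat)) (S n)).
    rewrite (sum_pascal (fun k => a k * b (S n - k)%nat)), !IH.
    rewrite Rplus_comm.
    etransitivity; [symmetry; apply (sum_n_plus (G := R_AbelianMonoid))|].
    apply sum_n_ext_loc; intros k Hk; unfold plus, hshift; simpl.
    replace (S n - k)%nat with (S (n - k)) by lia.
    replace (match k with O => S n | S l => (n - l)%nat end) with (S (n - k)) by
      (destruct k; lia).
    ring.
Qed.

(** * The series 2 / (exp z + 1) *)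

Lemma hpow_geometric (a : hseries) (n : nat) :
  ((hconst 1 - a) * hsum (hpow a) n = hconst 1 - a ^ S n)%H.
Proof.
  induction n as [|n IH].
  - rewrite hsum_O; simpl; ring.
  - rewrite hsum_S.
    replace ((hconst 1 - a) * (hsum (hpow a) n + a ^ S n))%H
      with ((hconst 1 - a) * hsum (hpow a) n + (hconst 1 - a) * a ^ S n)%H by ring.
    rewrite IH; simpl; ring.
Qed.

(** Since [a ^ k] has no coefficient below [k], cutting the geometric series at [k <= n] is exact
    for the coefficient [n]. So for each [n] the inverse may be replaced by a finite geometric sum,
    up to a remainder vanishing through order [n]. *)
Lemma hmul_geometric_inverse (a : hseries) : a O = 0 ->
  ((hconst 1 - a) * (fun n => sum_n (fun k => (a ^ k)%H n) n) = hconst 1)%H.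
Proof.
  intro Ha; apply functional_extensionality; intro n.
  set (b := fun n => sum_n (fun k => (a ^ k)%H n) n).
  replace b with (hsum (hpow a) n + (b - hsum (hpow a) n))%H by ring.
  rewrite (hmul_comm (hconst 1 - a)), hmul_add_l.
  rewrite (hmul_comm (hsum _ _)), hpow_geometric, (hmul_comm (b - _)%H).
  unfold hadd at 1; unfold hsub at 1.
  rewrite (hpow_vanish a (S n) Ha n) by lia.
  rewrite (hmul_vanish _ _ 0 (S n)); [ring | intros; lia | | lia].
  intros k Hk; unfold hsub, hsum, b.
  assert (H : forall d, sum_n (fun j => (a ^ j)%H k) (k + d)
                 = sum_n (fun j => (a ^ j)%H k) k).
  { induction d as [|d IH]; [f_equal; lia|].
    rewrite Nat.add_succ_r, sum_Sn, IH, (hpow_vanish a (S (k + d)) Ha k) by lia.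
    unfold plus; simpl; ring. }
  rewrite <- (H (n - k)%nat); replace (k + (n - k))%nat with n by lia; ring.
Qed.

(** The geometric series of [1 / (1 - (1 - exp z) / 2) = 2 / (1 + exp z)]. The index [n] is also the
    truncation bound, which makes each coefficient a finite sum. *)
Definition heuler : hseries := fun n =>
  sum_n (fun k => ((hconst (1 / 2) * (hconst 1 - hexp 1)) ^ k)%H n) n.

Lemma hconst_2 : hconst 2 = (hconst 1 + hconst 1)%H.
Proof. rewrite <- hconst_add; f_equal; ring. Qed.

Lemma hconst_half : (hconst 2 * hconst (1 / 2) = hconst 1)%H.
Proof. rewrite <- hconst_mul; f_equal; field. Qed.

Lemma heuler_spec : ((hconst 1 + hexp 1) * heuler = hconst 2)%H.
Proof.
  assert (H : hmul (hconst 1 - hconst (1 / 2) * (hconst 1 - hexp 1))%H heuler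
              = hconst 1).
  { apply hmul_geometric_inverse; rewrite hmul_const_l; cbv; ring. }
  transitivity (hconst 2
    * ((hconst 1 - hconst (1 / 2) * (hconst 1 - hexp 1)) * heuler))%H.
  2:{ rewrite H; ring. }
  replace (hconst 2 * ((hconst 1 - hconst (1 / 2) * (hconst 1 - hexp 1)) * heuler))%H
    with ((hconst 2 - (hconst 2 * hconst (1 / 2)) * (hconst 1 - hexp 1)) * heuler)%H
    by ring.
  rewrite hconst_half, hconst_2; ring.
Qed.

Lemma heuler_unique (a : hseries) :
  ((hconst 1 + hexp 1) * a = hconst 2)%H -> a = heuler.
Proof.
  intro H; apply (hmul_cancel (hconst 1 + hexp 1)%H).
  - cbv; lra.
  - rewrite H, heuler_spec; reflexivity.
Qed.

(** Write [f] for [heuler] and [e] for [exp z]. Differentiating [(1 + e) f = 2] gives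
    [(1 + e) f' = - e f = f - 2], and multiplying by [f] gives [2 f' = f^2 - 2 f]. *)
Lemma heuler_riccati :
  (hconst 2 * hshift heuler
   = (heuler - hconst 1) * (heuler - hconst 1) - hconst 1)%H.
Proof.
  pose proof heuler_spec as H.
  assert (H' : hshift ((hconst 1 + hexp 1) * heuler)%H = hconst 0).
  { rewrite H; apply hshift_const. }
  rewrite hshift_mul, hshift_add, hshift_const, hshift_exp in H'.
  rewrite <- H at 1.
  transitivity (heuler * ((hconst 1 + hexp 1) * hshift heuler))%H; [ring|].
  replace ((hconst 1 + hexp 1) * hshift heuler)%H with
    (((hconst 0 + hconst 1 * hexp 1) * heuler + (hconst 1 + hexp 1) * hshift heuler)
      - ((hconst 1 + hexp 1) * heuler - heuler))%H by ring.
  rewrite H', H, hconst_2; ring.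
Qed.

Lemma heuler_O : heuler O = 1.
Proof. unfold heuler; rewrite sum_O; reflexivity. Qed.

Lemma heuler_coef (n : nat) :
  2 * heuler (S n)
  = ((heuler - hconst 1) * (heuler - hconst 1))%H n - hconst 1 n.
Proof.
  change (heuler (S n)) with (hshift heuler n).
  rewrite <- hmul_const_l, heuler_riccati; reflexivity.
Qed.

(** [f - 1] is an odd function. Formally: in a coefficient of odd index of [(f - 1)^2], each product
    has one factor of smaller even index, which vanishes by induction. *)
Lemma heuler_even (j : nat) : (heuler - hconst 1)%H (2 * j)%nat = 0.
Proof.
  induction j as [j IH] using Wf_nat.lt_wf_ind.
  destruct j as [|j]; [unfold hsub; simpl; rewrite heuler_O; ring|].
  replace (2 * S j)%nat with (S (S (2 * j))) by lia.
  pose proof (heuler_coef (S (2 * j))) as H.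
  rewrite hmul_coef_sum in H.
  rewrite (sum_n_ext_loc _ (fun _ => 0)), sum_n_const in H.
  - unfold hsub; simpl in H |- *; lra.
  - intros k Hk.
    destruct (Nat.Even_or_Odd k) as [[i Hi]|[i Hi]]; rewrite Hi.
    + rewrite IH by lia; real_eq; ring.
    + replace (S (2 * j) - (2 * i + 1))%nat with (2 * (j - i))%nat by lia.
      rewrite (IH (j - i)%nat) by lia; real_eq; ring.
Qed.

Lemma heuler_odd_recursion (m : nat) : (1 <= m)%nat ->
  heuler (2 * m + 1)%nat
  = 1 / 2 * sum_n_m (fun k => Binomial.C (2 * m) (2 * k - 1)
      * heuler (2 * k - 1)%nat * heuler (2 * (m - k) + 1)%nat) 1 m.
Proof.
  intro hm.
  pose proof (heuler_coef (2 * m)) as H.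
  rewrite hmul_coef_sum in H.
  rewrite (sum_n_odd (fun k => Binomial.C (2 * m) k * (_ k * _ (2 * m - k)%nat))) in H.
  2:{ intros j Hj; rewrite heuler_even; real_eq; ring. }
  rewrite Nat.add_1_r.
  (* This needs [m >= 1]: the constant [1] of the Riccati equation lives in degree [0]. *)
  replace (hconst 1 (2 * m)%nat) with 0 in H by (destruct m; [lia | reflexivity]).
  rewrite (sum_n_m_ext_loc _ (fun k => Binomial.C (2 * m) (2 * k - 1)
      * heuler (2 * k - 1)%nat * heuler (2 * (m - k) + 1)%nat)) in H; [lra|].
  intros k Hk.
  assert (Hg : forall i, (heuler - hconst 1)%H (S i) = heuler (S i)).
  { intro i; unfold hsub; simpl; ring. }
  replace (2 * m - (2 * k - 1))%nat with (S (2 * (m - k))) by lia.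
  replace (2 * k - 1)%nat with (S (2 * (k - 1))) by lia.
  rewrite !Hg, Nat.add_1_r; real_eq; ring.
Qed.

Lemma heuler_1 : heuler 1%nat = - (1 / 2).
Proof.
  pose proof (heuler_coef 0) as H.
  unfold hmul, hsub in H; simpl in H; rewrite heuler_O in H; lra.
Qed.

(** * Powers of cosh and the formula for [Lambda] *)

Definition hcosh : hseries := (hconst (1 / 2) * (hexp 1 + hexp (-1)))%H.
Definition hsinh : hseries := (hconst (1 / 2) * (hexp 1 - hexp (-1)))%H.

Lemma hexp_1_opp : (hexp 1 * hexp (-1) = hconst 1)%H.
Proof. rewrite <- hexp_add, <- hexp_0; f_equal; ring. Qed.

Lemma hshift_cosh : hshift hcosh = hsinh.
Proof.
  unfold hcosh, hsinh.
  rewrite hshift_mul, hshift_add, hshift_const, !hshift_exp.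
  replace (hconst (-1)) with (- hconst 1)%H
    by (apply functional_extensionality; intros [|n]; cbv; ring).
  ring.
Qed.

(** Apply the binomial theorem to [cosh z = exp (-z) * (1 + exp (2 z)) / 2]. At [n = 2 * m] the
    right side is the inner sum of [Lambda] with its factor [1 / 2 ^ l]. *)
Lemma hcosh_pow_coef (l n : nat) :
  (hcosh ^ l)%H n
  = 1 / 2 ^ l * sum_n (fun q => Binomial.C l q * (2 * INR q - INR l) ^ n) l.
Proof.
  replace hcosh with (hconst (1 / 2) * (hexp (-1) * (hconst 1 + hexp 2)))%H.
  2:{ unfold hcosh; replace 2 with (1 + 1) at 2 by ring; rewrite hexp_add.
      replace (hexp (-1) * (hconst 1 + hexp 1 * hexp 1))%H
        with (hexp (-1) + (hexp 1 * hexp (-1)) * hexp 1)%H by ring.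
      rewrite hexp_1_opp; ring. }
  rewrite !hpow_mul, <- hconst_pow, hmul_const_l, hpow_one_add, hsum_mul_l.
  f_equal; [unfold Rdiv; rewrite !Rmult_1_l; apply pow_inv|].
  apply sum_n_ext; intro q.
  replace (hexp (-1) ^ l * (hconst (Binomial.C l q) * hexp 2 ^ q))%H
    with (hconst (Binomial.C l q) * (hexp (-1) ^ l * hexp 2 ^ q))%H by ring.
  rewrite hmul_const_l, !hexp_pow, <- hexp_add; unfold hexp.
  do 2 f_equal; ring.
Qed.

(** With [N = 2 * m] it reduces [l * (1/l - 1/(N+1)) * C(N+1, l)] to [C(N, l)]; the factor [l] comes
    from differentiating [cosh ^ l]. *)
Lemma C_S_mul (N l : nat) : (l <= N)%nat ->
  Binomial.C (S N) l * (INR (S N) - INR l) = INR (S N) * Binomial.C N l.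
Proof.
  intro Hl; unfold Binomial.C.
  replace (S N - l)%nat with (S (N - l)) by lia.
  rewrite !fact_simpl, !mult_INR, (S_INR (N - l)), minus_INR, S_INR by lia.
  field.
  repeat split; try apply INR_fact_neq_0.
  rewrite <- minus_INR, <- S_INR by lia; apply not_0_INR; lia.
Qed.

(* With [P] the series whose coefficients are to be identified, the weights
   [1/l - 1/(2m+1)] are those for which [cosh P' = ((1 - cosh)^(2m) - 1) sinh]. *)
Lemma Lambda_heuler (m : nat) : (1 <= m)%nat ->
  Lambda m = 2 ^ (2 * m - 1) * heuler (2 * m - 1)%nat.
Proof.
  intro hm.
  set (coef := fun l => (-1) ^ l * (1 / INR l - 1 / INR (2 * m + 1))
                 * Binomial.C (2 * m + 1) l).
  set (P := hsum (fun j => hconst (coef (S j)) * hcosh ^ S j)%H (2 * m - 1)).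
  assert (HP : Lambda m = P (2 * m)%nat).
  { unfold Lambda, P, hsum; rewrite sum_n_m_from_1 by lia.
    apply sum_n_ext; intro j.
    rewrite hmul_const_l, hcosh_pow_coef; unfold sum_n, coef.
    set (s := sum_n_m _ 0 (S j)); change (sum_n_m _ 0 (S j)) with s; clearbody s.
    real_eq; ring. }
  rewrite HP.
  assert (HP' : (hcosh * hshift P + hsinh
                 = (hconst 1 + - hcosh) ^ (2 * m) * hsinh)%H).
  { transitivity (hsinh * hsum (fun l => hconst (Binomial.C (2 * m) l)
                    * (- hcosh) ^ l)%H (2 * m))%H.
    2:{ rewrite hpow_one_add; ring. }
    unfold P; rewrite hshift_sum, !hsum_mul_l.
    apply functional_extensionality; intro n; unfold hadd, hsum.
    (* The term [l = 0] of the binomial expansion is the isolated [sinh]; the others match the terms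
       of [cosh * P'] one by one. *)
    unfold sum_n at 2; rewrite sum_Sn_m by lia.
    rewrite sum_n_m_from_1 by lia.
    rewrite C_n_0; change ((- hcosh) ^ 0)%H with (hconst 1).
    replace (hsinh * (hconst 1 * hconst 1))%H with hsinh by ring.
    rewrite Rplus_comm; apply (f_equal (Rplus _)).
    apply sum_n_ext_loc; intros j Hj.
    apply (f_equal (fun a : hseries => a n)).
    rewrite hshift_mul, hshift_const, hshift_pow, hshift_cosh.
    replace (- hcosh)%H with (hconst (-1) * hcosh)%H.
    2:{ apply functional_extensionality; intro k; rewrite hmul_const_l.
        unfold hopp; ring. }
    rewrite hpow_mul, <- hconst_pow.
    transitivity (hconst (coef (S j) * INR (S j)) * (hcosh ^ S j * hsinh))%H.
    { rewrite hconst_mul; simpl; ring. }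
    transitivity (hconst (Binomial.C (2 * m) (S j) * (-1) ^ S j)
                  * (hcosh ^ S j * hsinh))%H.
    2:{ rewrite hconst_mul; simpl; ring. }
    f_equal; f_equal; unfold coef.
    pose proof (C_S_mul (2 * m) (S j) ltac:(lia)) as HC.
    rewrite Nat.add_1_r.
    assert (INR (S (2 * m)) <> 0) by (apply not_0_INR; lia).
    assert (INR (S j) <> 0) by (apply not_0_INR; lia).
    apply (Rmult_eq_reg_l (INR (S (2 * m)))); [|assumption].
    transitivity ((-1) ^ S j * (INR (S (2 * m)) * Binomial.C (2 * m) (S j)));
      [rewrite <- HC; field; split; assumption | ring]. }
  assert (HF : ((hconst 1 + hexp 2) * hdil 2 heuler = hconst 2)%H).
  { replace (hconst 1 + hexp 2)%H with (hdil 2 (hconst 1 + hexp 1)%H).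
    2:{ apply functional_extensionality; intros [|k]; unfold hdil, hadd, hexp;
        simpl; rewrite ?pow1; ring. }
    rewrite <- hdil_mul, heuler_spec.
    apply functional_extensionality; intros [|k]; unfold hdil; simpl; ring. }
  (* As functions, [2 / (1 + exp (2 z)) = 1 - tanh z]. *)
  assert (HT : (hcosh * hdil 2 heuler = hcosh - hsinh)%H).
  { transitivity (hconst (1 / 2) * hexp (-1)
                  * ((hconst 1 + hexp 2) * hdil 2 heuler))%H.
    - unfold hcosh; replace 2 with (1 + 1) at 4 by ring; rewrite hexp_add.
      replace (hexp 1) with (hexp 1 * (hexp 1 * hexp (-1)))%H at 1; [ring|].
      rewrite hexp_1_opp; ring.
    - rewrite HF, hconst_2; unfold hcosh, hsinh; ring. }
  (* Multiplied by [cosh], this series is [(1 - cosh)^(2m) * sinh], of order at least [2m] because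
     [1 - cosh] has no constant term. The coefficient [2m - 1] of [P'] is the coefficient [2m] of
     [P], that is, [Lambda m]. *)
  assert (HV : (hshift P - hdil 2 heuler + hconst 1)%H (2 * m - 1)%nat = 0).
  { apply (hmul_cancel_vanish hcosh _ (2 * m)); [cbv; lra | | lia].
    intros n Hn.
    replace (hcosh * (hshift P - hdil 2 heuler + hconst 1))%H
      with (hcosh * hshift P + hsinh - hsinh - hcosh * hdil 2 heuler + hcosh)%H by ring.
    rewrite HP', HT.
    replace ((hconst 1 + - hcosh) ^ (2 * m) * hsinh - hsinh - (hcosh - hsinh) + hcosh)%H
      with ((hconst 1 + - hcosh) ^ (2 * m) * hsinh)%H by ring.
    apply (hmul_vanish _ _ (2 * m) 0); [|intros; lia | lia].
    apply hpow_vanish; unfold hadd, hopp, hcosh; rewrite hmul_const_l; cbv; lra. }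
  unfold hadd, hsub, hshift, hdil in HV.
  replace (S (2 * m - 1)) with (2 * m)%nat in HV by lia.
  replace (hconst 1 (2 * m - 1)%nat) with 0 in HV; [lra|].
  replace (2 * m - 1)%nat with (S (2 * (m - 1))) by lia; reflexivity.
Qed.

(** * Eulerian numbers and the formula for [Sigma] *)

Lemma hsum_alternating (c : nat -> R) (a : hseries) (M : nat) :
  ((hconst 1 + a)
     * hsum (fun j => hsum (fun l => hconst (c l) * (- a) ^ (j - l))%H j) M
   = hsum (fun j => hconst (c j)) M
     + a * hsum (fun l => hconst (c l) * (- a) ^ (M - l))%H M)%H.
Proof.
  induction M as [|M IH].
  - rewrite !hsum_O; simpl; ring.
  - rewrite !(hsum_S _ M), (hmul_comm (hconst 1 + a)), hmul_add_l.
    rewrite (hmul_comm _ (hconst 1 + a)), IH.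
    (* With [h_j] the inner sum, [h_(M+1) = c_(M+1) - a * h_M]; adding [a] times the previous sum
       therefore leaves only [c_(M+1)], and [a * h_M] remains at the end. *)
    assert (H : hsum (fun l => hconst (c l) * (- a) ^ (S M - l))%H M
      = (- a * hsum (fun l => hconst (c l) * (- a) ^ (M - l)) M)%H).
    { rewrite hsum_mul_l; apply hsum_ext; intros l Hl.
      replace (S M - l)%nat with (S (M - l)) by lia; simpl; ring. }
    rewrite H, Nat.sub_diag; simpl; ring.
Qed.

Lemma hopp_exp_pow (c : R) (k : nat) :
  ((- hexp c) ^ k = hconst ((-1) ^ k) * hexp (INR k * c))%H.
Proof.
  replace (- hexp c)%H with (hconst (-1) * hexp c)%H.
  - rewrite hpow_mul, hexp_pow, hconst_pow; reflexivity.
  - apply functional_extensionality; intro n; rewrite hmul_const_l.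
    unfold hopp; ring.
Qed.

(* The Eulerian number [A(n, j-1)] when [N = n + 1]. *)
Definition eulerian (N n j : nat) : R :=
  sum_n (fun l => (-1) ^ l * Binomial.C N l * (INR j - INR l) ^ n) j.

Lemma pow_opp1_sqr (m : nat) : (-1) ^ m * (-1) ^ m = 1.
Proof. rewrite <- Rpow_mult_distr; replace (-1 * -1) with 1 by ring; apply pow1. Qed.

Lemma pow_opp1_sub (j l : nat) : (l <= j)%nat -> (-1) ^ (j - l) = (-1) ^ j * (-1) ^ l.
Proof.
  intro H; replace j with (j - l + l)%nat at 2 by lia.
  rewrite pow_add, Rmult_assoc, <- pow_add.
  replace (l + l)%nat with (2 * l)%nat by lia.
  rewrite pow_1_even; ring.
Qed.

(** [(-exp z)^(j-l)] has coefficient [(-1)^(j-l) * (j-l)^n], so the alternating Eulerian sum is the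
    coefficient [n] of the double sum in [hsum_alternating], taken with [c = C(N, .)] and
    [a = exp z]. *)
Lemma eulerian_alternating (N n : nat) : (n < N)%nat ->
  2 * sum_n (fun j => (-1) ^ j * eulerian N n j) N = 2 ^ N * heuler n.
Proof.
  intro Hn.
  set (H := fun j => hsum (fun l => hconst (Binomial.C N l)
                                    * (- hexp 1) ^ (j - l))%H j).
  assert (E : sum_n (fun j => (-1) ^ j * eulerian N n j) N = hsum H N n).
  { unfold hsum at 1; apply sum_n_ext; intro j; unfold H, hsum, eulerian.
    rewrite <- sum_n_Rmult_l.
    apply sum_n_ext_loc; intros l Hl.
    rewrite hmul_const_l, hopp_exp_pow, hmul_const_l, pow_opp1_sub, minus_INR by lia.
    unfold hexp, mult; simpl; rewrite Rmult_1_r; ring. }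
  rewrite E.
  assert (HS : hsum (fun j => hconst (Binomial.C N j)) N = hconst (2 ^ N)).
  { rewrite hconst_pow, hconst_2, hpow_one_add.
    apply hsum_ext; intros k _.
    rewrite <- hconst_pow, <- hconst_mul, pow1, Rmult_1_r; reflexivity. }
  (* The exponents [N - l] are brought to the form of the binomial theorem by factoring out
     [(-exp z)^N], which leaves powers of [-exp (-z)]. *)
  assert (HN : H N = ((hconst 1 + - hexp 1) ^ N)%H).
  { transitivity ((- hexp 1) ^ N * (hconst 1 + - hexp (-1)) ^ N)%H.
    - rewrite hpow_one_add, hsum_mul_l; apply hsum_ext; intros l Hl.
      rewrite !hopp_exp_pow, pow_opp1_sub, minus_INR by lia.
      rewrite hconst_mul, Rmult_minus_distr_r; unfold Rminus; rewrite hexp_add.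
      replace (- (INR l * 1)) with (INR l * -1) by ring; ring.
    - rewrite <- hpow_mul; f_equal.
      transitivity (hexp 1 * hexp (-1) - hexp 1)%H; [ring|].
      rewrite hexp_1_opp; ring. }
  assert (HV : (hconst 2 * hsum H N - hconst (2 ^ N) * heuler)%H n = 0).
  { apply (hmul_cancel_vanish (hconst 1 + hexp 1)%H _ N); [cbv; lra | | lia].
    intros k Hk.
    replace ((hconst 1 + hexp 1)
             * (hconst 2 * hsum H N - hconst (2 ^ N) * heuler))%H
      with (hconst 2 * ((hconst 1 + hexp 1) * hsum H N)
            - hconst (2 ^ N) * ((hconst 1 + hexp 1) * heuler))%H by ring.
    rewrite heuler_spec; unfold H at 1; rewrite hsum_alternating, HS.
    fold (H N); rewrite HN.
    replace (hconst 2 * (hconst (2 ^ N) + hexp 1 * (hconst 1 + - hexp 1) ^ N)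
             - hconst (2 ^ N) * hconst 2)%H
      with ((hconst 1 + - hexp 1) ^ N * (hconst 2 * hexp 1))%H by ring.
    apply (hmul_vanish _ _ N 0); [|intros; lia | lia].
    apply hpow_vanish; cbv; lra. }
  unfold hsub in HV; rewrite !hmul_const_l in HV; lra.
Qed.

(** The left side is a coefficient of [exp (y z) * (1 - exp (-z))^N], whose order is at least
    [N]. *)
Lemma finite_difference_vanish (N n : nat) (y : R) : (n < N)%nat ->
  sum_n (fun l => (-1) ^ l * Binomial.C N l * (y - INR l) ^ n) N = 0.
Proof.
  intro Hn.
  transitivity ((hexp y * (hconst 1 + - hexp (-1)) ^ N)%H n).
  - rewrite hpow_one_add, hsum_mul_l; apply sum_n_ext; intro l.
    rewrite hopp_exp_pow.
    replace (hexp y * (hconst (Binomial.C N l)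
               * (hconst ((-1) ^ l) * hexp (INR l * -1))))%H
      with (hconst (Binomial.C N l) * (hconst ((-1) ^ l)
               * (hexp y * hexp (INR l * -1))))%H by ring.
    rewrite <- hexp_add, !hmul_const_l; unfold hexp.
    replace (y + INR l * -1) with (y - INR l) by ring; real_eq; ring.
  - apply (hmul_vanish _ _ 0 N); [intros; lia | | lia].
    apply hpow_vanish; cbv; lra.
Qed.

(** The sum extended to all [l <= 2m] is an [N]-th finite difference with [N = 2m], hence [0]. The
    part [l >= j], reversed by [l -> 2m - l], is the sum for [2m - j] up to the sign coming from the
    odd exponent [2m - 1]. *)
Lemma eulerian_symmetric (m j : nat) : (1 <= m)%nat -> (j <= 2 * m)%nat ->
  eulerian (2 * m) (2 * m - 1) (2 * m - j) = eulerian (2 * m) (2 * m - 1) j.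
Proof.
  intros hm Hj; unfold eulerian at 2.
  set (t := fun l => (-1) ^ l * Binomial.C (2 * m) l * (INR j - INR l) ^ (2 * m - 1)).
  assert (Hodd : forall x, (- x) ^ (2 * m - 1) = - x ^ (2 * m - 1)).
  { intro x; replace (- x) with (-1 * x) by ring; rewrite Rpow_mult_distr.
    replace (2 * m - 1)%nat with (S (2 * (m - 1))) by lia.
    rewrite pow_1_odd; ring. }
  assert (Htj : t j = 0).
  { unfold t; rewrite Rminus_diag, pow_i by lia; ring. }
  assert (Ht : sum_n_m t j (2 * m) = - eulerian (2 * m) (2 * m - 1) (2 * m - j)).
  { rewrite sum_n_m_from by lia; unfold eulerian; rewrite <- sum_n_rev.
    match goal with |- _ = - ?s => replace (- s) with (-1 * s) by ring end.
    rewrite <- sum_n_Rmult_l.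
    apply sum_n_ext_loc; intros k Hk; unfold t.
    replace (j + (2 * m - j - k))%nat with (2 * m - k)%nat by lia.
    rewrite pow_opp1_sub, pow_1_even, <- (pascal_step1 (2 * m) k) by lia.
    replace (INR j - INR (2 * m - k)) with (- (INR (2 * m - j) - INR k))
      by (rewrite !minus_INR by lia; ring).
    rewrite Hodd.
    real_eq; ring. }
  (* The two parts overlap in [l = j], whose term is [0]. *)
  assert (Hs : sum_n t (2 * m) + t j = sum_n t j + sum_n_m t j (2 * m)).
  { unfold sum_n; rewrite (sum_Sn_m t j) by lia.
    rewrite (sum_n_m_Chasles t 0 j (2 * m)) by lia.
    unfold plus; simpl; ring. }
  unfold t in Hs at 1; rewrite finite_difference_vanish, Htj, Ht in Hs by lia.
  change (eulerian (2 * m) (2 * m - 1) (2 * m - j) = sum_n t j); lra.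
Qed.

(** The sums in [Sigma] are Eulerian numbers at [m] and at [m - k], so [Sigma] is, up to [(-1) ^ m],
    the alternating sum over [0 .. 2m] folded about [m]. *)
Lemma Sigma_heuler (m : nat) : (1 <= m)%nat ->
  Sigma m = (-1) ^ m * 2 ^ (2 * m - 1) * heuler (2 * m - 1)%nat.
Proof.
  intro hm.
  set (a := eulerian (2 * m) (2 * m - 1)).
  (* [Sigma] stops at [l = i - 1] where [eulerian] stops at [l = i]; the extra term is a positive
     power of [0]. *)
  assert (Ha : forall i, (1 <= i)%nat -> sum_n_m (fun l => (-1) ^ l * Binomial.C (2 * m) l
                * (INR i - INR l) ^ (2 * m - 1)) 0 (i - 1) = a i).
  { intros i Hi; unfold a, eulerian.
    destruct i as [|i]; [lia|].
    rewrite (sum_Sn _ i), Rminus_diag, pow_i by lia.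
    replace (S i - 1)%nat with i by lia.
    rewrite Rmult_0_r; symmetry; apply Rplus_0_r. }
  pose proof (eulerian_alternating (2 * m) (2 * m - 1) ltac:(lia)) as H.
  rewrite sum_n_symmetric in H.
  2:{ intros j Hj; rewrite eulerian_symmetric, pow_opp1_sub, pow_1_even by lia; ring. }
  unfold Sigma; rewrite Ha by lia.
  rewrite (sum_n_m_ext_loc _ (fun k => (-1) ^ m * ((-1) ^ (m - k) * a (m - k)%nat))
            1 (m - 1)).
  2:{ intros k Hk; rewrite <- Ha by lia.
      rewrite pow_opp1_sub by lia.
      rewrite (sum_n_m_ext _ (fun l => (-1) ^ l * Binomial.C (2 * m) l
                * (INR (m - k) - INR l) ^ (2 * m - 1))).
      2:{ intro l; rewrite minus_INR by lia; reflexivity. }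
      rewrite <- !Rmult_assoc, <- pow_add.
      replace (m + m)%nat with (2 * m)%nat by lia.
      rewrite pow_1_even; real_eq; ring. }
  rewrite sum_n_m_Rmult_l.
  fold a in H.
  (* Folding runs up to [k = m] but [Sigma] only to [m - 1]; the extra Eulerian number, at [0],
     vanishes. *)
  assert (HS : sum_n_m (fun k => (-1) ^ (m - k) * a (m - k)%nat) 1 m
    = sum_n_m (fun k => (-1) ^ (m - k) * a (m - k)%nat) 1 (m - 1)).
  { destruct m as [|p]; [lia|].
    rewrite (sum_n_Sm _ 1 p), Nat.sub_diag by lia.
    replace (S p - 1)%nat with p by lia.
    replace (a O) with 0; [rewrite Rmult_0_r; apply Rplus_0_r|].
    unfold a, eulerian; rewrite sum_O; simpl INR.
    rewrite Rminus_diag, pow_i by lia; symmetry; apply Rmult_0_r. }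
  rewrite HS in H.
  set (s := sum_n_m _ 1 (m - 1)) in *.
  replace (2 ^ (2 * m)) with (2 * 2 ^ (2 * m - 1)) in H
    by (rewrite tech_pow_Rmult; f_equal; lia).
  pose proof (pow_opp1_sqr m) as Hsq.
  rewrite Rmult_assoc.
  replace (2 ^ (2 * m - 1) * heuler (2 * m - 1)%nat) with ((-1) ^ m * a m + 2 * s) by lra.

  transitivity ((-1) ^ m * (-1) ^ m * a m + 2 * ((-1) ^ m * s)); [rewrite Hsq|]; ring.
Qed.

(** * From convergent to formal series *)

Definition is_egf (r : R) (a : hseries) (F : R -> R) : Prop :=
  forall x, Rabs x < r -> is_series (fun n => a n * (x ^ n / INR (fact n))) (F x).

Definition egf_coef (a : hseries) : nat -> R := fun n => a n / INR (fact n).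

Lemma is_egf_pseries (r : R) (a : hseries) (F : R -> R) (x : R) :
  is_egf r a F -> Rabs x < r -> is_pseries (egf_coef a) x (F x).
Proof.
  intros H Hx; apply is_pseries_R.
  apply (is_series_ext (fun n => a n * (x ^ n / INR (fact n)))); [|exact (H x Hx)].
  intro n; unfold egf_coef, Rdiv; real_eq; ring.
Qed.

(** Convergence at a point [y] strictly between [Rabs x] and [r] puts [Rabs x] strictly inside the
    disk, since outside the closed disk the terms cannot tend to [0]. *)
Lemma is_egf_radius (r : R) (a : hseries) (F : R -> R) (x : R) :
  is_egf r a F -> Rabs x < r -> Rbar_lt (Rabs x) (CV_radius (egf_coef a)).
Proof.
  intros H Hx; apply Rbar_not_le_lt; intro Hle.
  pose proof (Rabs_pos x) as H0.
  set (y := (Rabs x + r) / 2).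
  assert (Hy : Rabs y = y) by (apply Rabs_pos_eq; unfold y; lra).
  apply (CV_disk_outside (egf_coef a) y).
  - apply (Rbar_le_lt_trans _ (Rabs x)); [assumption|].
    rewrite Hy; simpl; unfold y; lra.
  - apply (is_lim_seq_ext (fun n => a n * (y ^ n / INR (fact n)))).
    { intro n; unfold egf_coef, Rdiv; ring. }
    apply ex_series_lim_0; exists (F y); apply H.
    rewrite Hy; unfold y; lra.
Qed.

Lemma is_egf_mul (r : R) (a b : hseries) (F G : R -> R) :
  is_egf r a F -> is_egf r b G -> is_egf r (a * b)%H (fun x => F x * G x).
Proof.
  intros Ha Hb x Hx.
  pose proof (is_pseries_mult (egf_coef a) (egf_coef b) x (F x) (G x)
    (is_egf_pseries r a F x Ha Hx) (is_egf_pseries r b G x Hb Hx)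
    (is_egf_radius r a F x Ha Hx) (is_egf_radius r b G x Hb Hx)) as H.
  apply is_pseries_R in H; revert H.
  apply is_series_ext; intro n; unfold PS_mult.
  rewrite <- sum_n_Reals, hmul_coef_sum.
  replace (x ^ n / INR (fact n)) with (/ INR (fact n) * x ^ n) by (unfold Rdiv; ring).
  rewrite <- Rmult_assoc; f_equal; rewrite Rmult_comm.
  rewrite <- sum_n_Rmult_l.
  apply sum_n_ext_loc; intros k Hk.
  unfold egf_coef, Binomial.C; simpl; real_eq; field.
  repeat split; apply INR_fact_neq_0.
Qed.

Lemma is_egf_add (r : R) (a b : hseries) (F G : R -> R) :
  is_egf r a F -> is_egf r b G -> is_egf r (a + b)%H (fun x => F x + G x).
Proof.
  intros Ha Hb x Hx.
  generalize (is_series_plus _ _ _ _ (Ha x Hx) (Hb x Hx)).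
  apply is_series_ext; intro n; unfold hadd, plus; simpl; ring.
Qed.

Lemma is_series_finite (a : nat -> R) (N : nat) (l : R) :
  (forall n, (N < n)%nat -> a n = 0) -> sum_n a N = l -> is_series a l.
Proof.
  intros Ha <-; change (is_lim_seq (sum_n a) (sum_n a N)).
  apply is_lim_seq_ext_loc with (fun _ => sum_n a N);
    [|apply is_lim_seq_const].
  exists N; intros n Hn; replace n with (N + (n - N))%nat by lia.
  generalize (n - N)%nat; intro d; induction d as [|d IH]; [f_equal; lia|].
  rewrite Nat.add_succ_r, sum_Sn, <- IH, Ha by lia; symmetry; apply Rplus_0_r.
Qed.

Lemma is_egf_const (r c : R) : is_egf r (hconst c) (fun _ => c).
Proof.
  intros x _.
  apply (is_series_finite _ 0).
  - intros [|n] Hn; [lia|]; simpl; ring.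
  - rewrite sum_O; simpl; field.
Qed.

Lemma is_egf_exp (r : R) : is_egf r (hexp 1) exp.
Proof.
  intros x _; generalize (is_exp_Reals x); intro H; apply is_pseries_R in H.
  revert H; apply is_series_ext; intro n; unfold hexp; rewrite pow1.
  unfold Rdiv; real_eq; ring.
Qed.

(** Carries a functional equation on a real interval over to formal series: each defining generating
    function is multiplied by its denominator, and the two sides are compared here. *)
Lemma is_egf_unique (r : R) (a b : hseries) (F G : R -> R) : 0 < r ->
  is_egf r a F -> is_egf r b G -> (forall x, Rabs x < r -> F x = G x) -> a = b.
Proof.
  intros Hr Ha Hb HFG; apply functional_extensionality; intro n.
  assert (H0 : Rabs 0 < r) by (rewrite Rabs_R0; assumption).
  assert (E : egf_coef a n = egf_coef b n).
  { apply PSeries_ext_recip.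
    - rewrite <- Rabs_R0; exact (is_egf_radius r a F 0 Ha H0).
    - rewrite <- Rabs_R0; exact (is_egf_radius r b G 0 Hb H0).
    - exists (mkposreal r Hr); intros x Hx.
      assert (Hx' : Rabs x < r).
      { replace x with (x - 0) by ring; exact Hx. }
      rewrite (is_pseries_unique _ _ _ (is_egf_pseries r a F x Ha Hx')).
      rewrite (is_pseries_unique _ _ _ (is_egf_pseries r b G x Hb Hx')).
      apply HFG; assumption. }
  unfold egf_coef in E; apply (Rmult_eq_reg_r (/ INR (fact n))); [exact E|].
  apply Rinv_neq_0_compat, INR_fact_neq_0.
Qed.

Lemma exp_add_1_neq_0 (x : R) : exp x + 1 <> 0.
Proof. pose proof (exp_pos x); lra. Qed.

Lemma euler_heuler (E : nat -> R -> R) (n : nat) :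
  is_euler_polynomials E -> E n 0 = heuler n.
Proof.
  intro HE.
  assert (H : is_egf PI (fun k => E k 0) (fun z => 2 * exp (0 * z) / (exp z + 1)))
    by exact (HE 0).
  rewrite <- (heuler_unique (fun k => E k 0)); [reflexivity|].
  apply (is_egf_unique PI _ _ _ _ PI_RGT_0
    (is_egf_mul _ _ _ _ _ (is_egf_add _ _ _ _ _ (is_egf_const _ 1) (is_egf_exp _)) H)
    (is_egf_const _ 2)).
  intros z _; rewrite Rmult_0_l, exp_0; field; apply exp_add_1_neq_0.
Qed.

Definition hvar : hseries := fun n => match n with 1%nat => 1 | _ => 0 end.

Lemma hvar_mul (a : hseries) (n : nat) : (hvar * a)%H (S n) = INR (S n) * a n.
Proof.
  revert a; induction n as [|n IH]; intro a;
    [unfold hmul; simpl; unfold hshift; simpl; ring|].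
  change ((hshift hvar * a)%H (S n) + (hvar * hshift a)%H (S n)
    = INR (S (S n)) * a (S n)).
  replace (hshift hvar) with (hconst 1)
    by (apply functional_extensionality; intros [|k]; reflexivity).
  rewrite IH, hmul_const_l, (S_INR (S n)); unfold hshift; ring.
Qed.

Lemma is_egf_var (r : R) : is_egf r hvar (fun x => x).
Proof.
  intros x _.
  apply (is_series_finite _ 1).
  - intros [|[|n]] Hn; try lia; simpl; ring.
  - rewrite sum_Sn, sum_O; unfold plus; simpl; field.
Qed.

Lemma genocchi_heuler (G : nat -> R) (n : nat) :
  is_genocchi G -> G (S n) = INR (S n) * heuler n.
Proof.
  intro HG; rewrite <- hvar_mul.
  (* The hypothesis does not constrain [G 0], so the constant coefficient is set to [0]. *)
  set (g := fun k => match k with O => 0 | S j => G (S j) end).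
  assert (H : is_egf PI g (fun z => 2 * z / (exp z + 1))).
  { intros z Hz; apply (is_series_decr_1 (V := R_NormedModule)).
    replace (plus _ _) with (2 * z / (exp z + 1)); [exact (HG z Hz)|].
    unfold plus, opp; simpl; unfold Rdiv; ring. }
  change (g (S n) = (hvar * heuler)%H (S n)).
  apply (f_equal (fun a : hseries => a (S n))).
  apply (hmul_cancel (hconst 1 + hexp 1)%H); [cbv; lra|].
  transitivity (hvar * ((hconst 1 + hexp 1) * heuler))%H; [|ring].
  rewrite heuler_spec.
  apply (is_egf_unique PI _ _ _ _ PI_RGT_0
    (is_egf_mul _ _ _ _ _ (is_egf_add _ _ _ _ _ (is_egf_const _ 1) (is_egf_exp _)) H)
    (is_egf_mul _ _ _ _ _ (is_egf_var _) (is_egf_const _ 2))).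
  intros z _; field; apply exp_add_1_neq_0.
Qed.

(** Comes from [z/(exp z - 1) - 2z/(exp (2z) - 1) = z/(exp z + 1)], where the second fraction is the
    first one dilated by [2]. *)
Lemma bernoulli_heuler (B : nat -> R) (n : nat) :
  is_bernoulli B -> 2 * (1 - 2 ^ S n) * B (S n) = INR (S n) * heuler n.
Proof.
  intro HB; rewrite <- hvar_mul.
  (* With the value [B 0] at the removable singularity the series converges to [F] there too, and
     [(exp x - 1) * F x = x] holds at [0] whatever [B 0] is. *)
  set (F := fun x => if Req_EM_T x 0 then B O else x / (exp x - 1)).
  assert (H : is_egf PI B F).
  { intros x Hx; unfold F; destruct (Req_EM_T x 0) as [->|Hx0].
    - apply (is_series_finite _ 0).
      + intros k Hk; rewrite pow_i by lia.
        unfold Rdiv; ring.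
      + rewrite sum_O; simpl; field.
    - apply HB; [assumption|]; pose proof PI_RGT_0; lra. }
  set (b := B : hseries).
  assert (Hb : ((hexp 1 - hconst 1) * b = hvar)%H).
  { replace (hexp 1 - hconst 1)%H with (hconst (-1) + hexp 1)%H.
    2:{ apply functional_extensionality; intros [|k]; cbv; ring. }
    apply (is_egf_unique PI _ _ _ _ PI_RGT_0
      (is_egf_mul _ _ _ _ _ (is_egf_add _ _ _ _ _ (is_egf_const _ (-1)) (is_egf_exp _)) H)
      (is_egf_var _)).
    intros x _; unfold F; destruct (Req_EM_T x 0) as [->|Hx]; [rewrite exp_0; ring|].
    field; intro E; apply Hx, exp_inv; rewrite exp_0; lra. }
  assert (Hb2 : ((hexp 1 * hexp 1 - hconst 1) * hdil 2 b = hconst 2 * hvar)%H).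
  { rewrite <- hexp_add.
    replace (hexp (1 + 1) - hconst 1)%H with (hdil 2 (hexp 1 - hconst 1)%H).
    2:{ apply functional_extensionality; intros [|k]; unfold hdil, hsub, hexp; simpl;
        rewrite ?pow1; replace (1 + 1) with 2 by ring; ring. }
    rewrite <- hdil_mul, Hb; apply functional_extensionality; intros [|[|k]];
      rewrite hmul_const_l; unfold hdil; simpl; ring. }
  (* [hmul_cancel] does not apply to [z], which has no constant term; [z] is cancelled by reading
     off coefficient [k + 1]. *)
  assert (Hv : forall u v, (hvar * u = hvar * v)%H -> u = v).
  { intros u v E; apply functional_extensionality; intro k.
    apply (Rmult_eq_reg_l (INR (S k))); [|apply not_0_INR; lia].
    rewrite <- !hvar_mul, E; reflexivity. }
  (* [e - 1] has no constant term: it is cancelled by multiplying by [b],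
     which turns it into the variable. *)
  assert (E1 : ((hconst 1 + hexp 1) * hdil 2 b = hconst 2 * b)%H).
  { apply Hv.
    transitivity (b * ((hexp 1 * hexp 1 - hconst 1) * hdil 2 b))%H;
      [rewrite <- Hb; ring | rewrite Hb2; ring]. }
  assert (E2 : (hconst 2 * (b - hdil 2 b) = hvar * heuler)%H).
  { apply (hmul_cancel (hconst 1 + hexp 1)%H); [cbv; lra|].
    transitivity (hvar * ((hconst 1 + hexp 1) * heuler))%H; [|ring].
    rewrite heuler_spec.
    transitivity (hconst 2 * ((hconst 1 + hexp 1) * b
                               - (hconst 1 + hexp 1) * hdil 2 b))%H; [ring|].
    rewrite E1, <- Hb, hconst_2; ring. }
  rewrite <- E2, hmul_const_l; unfold hsub, hdil, b; ring.
Qed.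

(** * Sums over odd integers and zeta values *)

Lemma mul_cos_le_sin (x : R) : 0 < x < PI / 2 -> x * cos x <= sin x.
Proof.
  intro Hx.
  destruct (MVT_cor2 sin cos 0 x) as [c [Hc Hcx]];
    [lra | intros; apply derivable_pt_lim_sin |].
  rewrite sin_0 in Hc.
  assert (cos x < cos c) by (apply cos_decreasing_1; lra).
  nra.
Qed.

(** The squared form of [sin x < x <= tan x], as [1/sin^2 - 1 = cot^2]. *)
Lemma inv_sqr_sin_bounds (x : R) : 0 < x < PI / 2 ->
  / sin x ^ 2 - 1 <= / x ^ 2 <= / sin x ^ 2.
Proof.
  intro Hx.
  assert (Hs : 0 < sin x) by (apply sin_gt_0; lra).
  pose proof (sin_lt_x x ltac:(lra)) as Hlt.
  pose proof (mul_cos_le_sin x Hx) as Hc.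
  assert (0 < cos x) by (apply cos_gt_0; lra).
  pose proof (sin2_cos2 x) as H1; unfold Rsqr in H1.
  split.
  - assert (H2 : (x * cos x) ^ 2 <= sin x ^ 2) by (apply pow_incr; nra).
    apply (Rmult_le_reg_l (x ^ 2 * sin x ^ 2)); [apply Rmult_lt_0_compat; apply pow_lt; lra|].
    replace (x ^ 2 * sin x ^ 2 * (/ sin x ^ 2 - 1)) with (x ^ 2 * (1 - sin x ^ 2))
      by (field; lra).
    replace (x ^ 2 * sin x ^ 2 * / x ^ 2) with (sin x ^ 2) by (field; lra).
    nra.
  - apply Rinv_le_contravar; [apply pow_lt; assumption|].
    apply pow_incr; lra.
Qed.

Lemma inv_sqr_sin_double (x : R) : 0 < x < PI / 2 ->
  / sin x ^ 2 + / sin (PI / 2 - x) ^ 2 = 4 * / sin (2 * x) ^ 2.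
Proof.
  intro Hx; rewrite sin_shift, sin_2a.
  assert (0 < sin x) by (apply sin_gt_0; lra).
  assert (0 < cos x) by (apply cos_gt_0; lra).
  pose proof (sin2_cos2 x) as H1; unfold Rsqr in H1.
  apply (Rmult_eq_reg_l (sin x ^ 2 * cos x ^ 2)).
  - transitivity (sin x * sin x + cos x * cos x); [|rewrite H1]; field; lra.
  - apply Rgt_not_eq, Rmult_lt_0_compat; apply pow_lt; assumption.
Qed.

Lemma sum_n_fold (u : nat -> R) (M : nat) : (1 <= M)%nat ->
  sum_n u (2 * M - 1) = sum_n (fun k => u k + u (2 * M - 1 - k)%nat) (M - 1).
Proof.
  intro HM.
  unfold sum_n at 1; rewrite (sum_n_m_Chasles u 0 (M - 1)) by lia.
  rewrite (sum_n_m_from _ (S (M - 1))) by lia.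
  rewrite <- (sum_n_rev (fun k => u (S (M - 1) + k)%nat)).
  replace (2 * M - 1 - S (M - 1))%nat with (M - 1)%nat by lia.
  symmetry; etransitivity; [apply (sum_n_plus (G := R_AbelianMonoid))|].
  apply (f_equal (Rplus _)).
  apply sum_n_ext_loc; intros k Hk; f_equal; lia.
Qed.

Lemma INR_pow2 (n : nat) : INR (2 ^ n) = 2 ^ n.
Proof. rewrite pow_INR; reflexivity. Qed.

Lemma INR_double (n : nat) : INR (2 * n) = 2 * INR n.
Proof. rewrite mult_INR; reflexivity. Qed.

(** At level [n + 1], the terms [k] and [2^(n+1) - 1 - k] have angles [x] and [PI/2 - x]; by
    duplication they add up to [4] times the term [k] of level [n]. The start is
    [1 / sin(PI/4)^2 = 2]. *)
Lemma inv_sqr_sin_sum (n : nat) :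
  sum_n (fun k => / sin (INR (2 * k + 1) * PI / 2 ^ (n + 2)) ^ 2) (2 ^ n - 1)
  = 2 * 4 ^ n.
Proof.
  induction n as [|n IH].
  - simpl (2 ^ 0 - 1)%nat; rewrite sum_O; simpl.
    replace (1 * PI / (2 * (2 * 1))) with (PI / 4) by field.
    rewrite sin_PI4, !Rmult_1_r.
    replace (1 / sqrt 2 * (1 / sqrt 2)) with (/ (sqrt 2 * sqrt 2)).
    + rewrite sqrt_sqrt by lra; field.
    + field; apply sqrt2_neq_0.
  - assert (Hp : (1 <= 2 ^ n)%nat) by (pose proof (Nat.pow_nonzero 2 n); lia).
    change (2 ^ S n)%nat with (2 * 2 ^ n)%nat.
    rewrite sum_n_fold by assumption.
    transitivity (4 * (2 * 4 ^ n)); [|simpl; ring].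
    rewrite <- IH, <- sum_n_Rmult_l.
    apply sum_n_ext_loc; intros k Hk; pose proof PI_RGT_0 as HPI.
    assert (H2 : 0 < 2 ^ (n + 2)) by (apply pow_lt; lra).
    assert (Hk2 : INR (2 * k + 1) < 2 ^ (n + 2) / 2).
    { replace (2 ^ (n + 2) / 2) with (INR (2 * 2 ^ n)).
      - apply lt_INR; lia.
      - rewrite INR_double, INR_pow2, pow_add; simpl; field. }
    assert (Hk0 : 0 < INR (2 * k + 1)) by (apply lt_0_INR; lia).
    set (x := INR (2 * k + 1) * PI / 2 ^ (S n + 2)).
    assert (Hx : 0 < x < PI / 2).
    { unfold x; simpl pow; split.
      - apply Rdiv_lt_0_compat; nra.
      - apply (Rmult_lt_reg_r (2 * 2 ^ (n + 2))); [lra|].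
        unfold Rdiv; rewrite Rmult_assoc, Rinv_l by lra; nra. }
    replace (INR (2 * k + 1) * PI / 2 ^ (n + 2)) with (2 * x).
    2:{ unfold x; simpl pow; field; lra. }
    rewrite <- inv_sqr_sin_double by assumption.
    do 4 f_equal.
    unfold x.
    replace (2 * (2 * 2 ^ n - 1 - k) + 1)%nat with (4 * 2 ^ n - (2 * k + 1))%nat by lia.
    rewrite minus_INR, mult_INR, INR_pow2 by lia.
    replace (INR 4) with 4 by (simpl; ring).
    replace (2 ^ (S n + 2)) with (8 * 2 ^ n) by (rewrite pow_add; simpl; ring).
    field; apply pow_nonzero; lra.
Qed.

Definition odd_sum (p N : nat) : R := sum_n (fun i => / INR (2 * i + 1) ^ p) N.

(** Replacing each of the [2^n] terms [1/sin^2] by [1/x^2] loses at most [1], against a total of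
    [2 * 4^n]; the rescaling factor [PI^2 / (16 * 4^n)] makes the loss [PI^2/16 * 2^(-n)]. *)
Lemma odd_sum_2_bounds (n : nat) :
  PI ^ 2 / 8 - PI ^ 2 / 16 * (1 / 2) ^ n <= odd_sum 2 (2 ^ n - 1) <= PI ^ 2 / 8.
Proof.
  pose proof PI_RGT_0 as HPI.
  assert (H2 : 0 < 2 ^ n) by (apply pow_lt; lra).
  assert (Hp : (1 <= 2 ^ n)%nat) by (pose proof (Nat.pow_nonzero 2 n); lia).
  set (x := fun k => INR (2 * k + 1) * PI / 2 ^ (n + 2)).
  assert (Hx : forall k, (k <= 2 ^ n - 1)%nat -> 0 < x k < PI / 2).
  { intros k Hk; unfold x.
    assert (Hk2 : INR (2 * k + 1) < 2 * 2 ^ n).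
    { replace (2 * 2 ^ n) with (INR (2 * 2 ^ n))
        by (rewrite INR_double, INR_pow2; reflexivity).
      apply lt_INR; lia. }
    assert (Hk0 : 0 < INR (2 * k + 1)) by (apply lt_0_INR; lia).
    replace (2 ^ (n + 2)) with (4 * 2 ^ n) by (rewrite pow_add; simpl; ring).
    split.
    - apply Rdiv_lt_0_compat; nra.
    - apply (Rmult_lt_reg_r (4 * 2 ^ n)); [lra|].
      unfold Rdiv; rewrite Rmult_assoc, Rinv_l by lra; nra. }
  assert (H4 : 4 ^ n = 2 ^ n * 2 ^ n)
    by (rewrite <- Rpow_mult_distr; f_equal; ring).
  assert (Hodd : sum_n (fun k => / x k ^ 2) (2 ^ n - 1)
                 = 16 * 4 ^ n / PI ^ 2 * odd_sum 2 (2 ^ n - 1)).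
  { unfold odd_sum; rewrite <- sum_n_Rmult_l.
    apply sum_n_ext; intro k; unfold x.
    replace (2 ^ (n + 2)) with (4 * 2 ^ n) by (rewrite pow_add; simpl; ring).
    rewrite H4.
    assert (INR (2 * k + 1) <> 0) by (apply not_0_INR; lia).
    real_eq; field; repeat split; lra. }
  pose proof (inv_sqr_sin_sum n) as HC; fold (x) in HC.
  assert (Hup : sum_n (fun k => / x k ^ 2) (2 ^ n - 1) <= 2 * 4 ^ n).
  { rewrite <- HC, !sum_n_Reals; apply sum_Rle; intros k Hk.
    apply inv_sqr_sin_bounds, Hx; assumption. }
  assert (Hlo : 2 * 4 ^ n - 2 ^ n <= sum_n (fun k => / x k ^ 2) (2 ^ n - 1)).
  { replace (2 ^ n) with (sum_n (fun _ => 1) (2 ^ n - 1)).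
    2:{ rewrite sum_n_const; replace (S (2 ^ n - 1)) with (2 ^ n)%nat by lia.
        rewrite INR_pow2; apply Rmult_1_r. }
    rewrite <- HC, !sum_n_Reals, <- minus_sum; apply sum_Rle; intros k Hk.
    apply inv_sqr_sin_bounds, Hx; assumption. }
  rewrite Hodd in Hup, Hlo.
  assert (Hh : (1 / 2) ^ n * 2 ^ n = 1)
    by (rewrite <- Rpow_mult_distr; replace (1 / 2 * 2) with 1 by field; apply pow1).
  set (o := odd_sum 2 (2 ^ n - 1)) in *.
  assert (Ho : o = PI ^ 2 / (16 * 4 ^ n) * (16 * 4 ^ n / PI ^ 2 * o)).
  { field; split; [lra | rewrite H4; nra]. }
  assert (Hpos : 0 < PI ^ 2 / (16 * 4 ^ n))
    by (apply Rdiv_lt_0_compat; [nra | rewrite H4; nra]).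
  apply (Rmult_le_compat_l _ _ _ (Rlt_le _ _ Hpos)) in Hup, Hlo.
  rewrite <- Ho in Hup, Hlo.
  replace (PI ^ 2 / (16 * 4 ^ n) * (2 * 4 ^ n)) with (PI ^ 2 / 8) in Hup
    by (field; rewrite H4; nra).
  replace (PI ^ 2 / (16 * 4 ^ n) * (2 * 4 ^ n - 2 ^ n))
    with (PI ^ 2 / 8 - PI ^ 2 / 16 * (1 / 2) ^ n) in Hlo; [split; assumption|].
  replace ((1 / 2) ^ n) with (/ 2 ^ n).
  - rewrite H4; field; lra.
  - apply (Rmult_eq_reg_r (2 ^ n)); [rewrite Hh; field|]; lra.
Qed.

Lemma odd_term_pos (p i : nat) : 0 < / INR (2 * i + 1) ^ p.
Proof. apply Rinv_0_lt_compat, pow_lt, lt_0_INR; lia. Qed.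

Lemma odd_sum_S (p N : nat) :
  odd_sum p (S N) = odd_sum p N + / INR (2 * S N + 1) ^ p.
Proof. exact (sum_Sn (fun i => / INR (2 * i + 1) ^ p) N). Qed.

Lemma odd_sum_incr (p N d : nat) : odd_sum p N <= odd_sum p (N + d).
Proof.
  induction d as [|d IH]; [rewrite Nat.add_0_r; lra|].
  rewrite Nat.add_succ_r, odd_sum_S.
  pose proof (odd_term_pos p (S (N + d))); lra.
Qed.

Lemma is_series_odd_2 : is_series (fun i => / INR (2 * i + 1) ^ 2) (PI ^ 2 / 8).
Proof.
  change (is_lim_seq (odd_sum 2) (PI ^ 2 / 8)).
  destruct (ex_finite_lim_seq_incr (odd_sum 2) (PI ^ 2 / 8)) as [l Hl].
  - intro N; rewrite <- (Nat.add_1_r N); apply odd_sum_incr.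
  - intro N; apply (Rle_trans _ (odd_sum 2 (2 ^ N - 1))); [|apply odd_sum_2_bounds].
    assert (H : (N < 2 ^ N)%nat) by (apply Nat.pow_gt_lin_r; lia).
    replace (2 ^ N - 1)%nat with (N + (2 ^ N - 1 - N))%nat by lia.
    apply odd_sum_incr.
  - replace (PI ^ 2 / 8) with l; [assumption|].
    (* The bounds are known only along [2^n - 1]; monotonicity supplies a limit, and this
       subsequence determines it. *)
    assert (Hsub : is_lim_seq (fun n => odd_sum 2 (2 ^ n - 1)) l).
    { apply (is_lim_seq_subseq (odd_sum 2)); [|assumption].
      apply eventually_subseq; intro n.
      pose proof (Nat.pow_nonzero 2 n); simpl; lia. }
    apply is_lim_seq_unique in Hsub.
    rewrite (is_lim_seq_unique _ (PI ^ 2 / 8)) in Hsub; [congruence|].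
    apply (is_lim_seq_le_le (fun n => PI ^ 2 / 8 - PI ^ 2 / 16 * (1 / 2) ^ n)
             _ (fun _ => PI ^ 2 / 8)); [exact odd_sum_2_bounds | | apply is_lim_seq_const].
    replace (Finite (PI ^ 2 / 8)) with (Finite (PI ^ 2 / 8 - PI ^ 2 / 16 * 0))
      by (f_equal; ring).
    apply is_lim_seq_minus'; [apply is_lim_seq_const|].
    apply (is_lim_seq_scal_l _ (PI ^ 2 / 16) 0).
    apply is_lim_seq_geom; rewrite Rabs_pos_eq; lra.
Qed.

Definition lam (p : nat) : R := Series (fun i => / INR (2 * i + 1) ^ p).

Lemma is_lim_odd_sum (p : nat) : (2 <= p)%nat -> is_lim_seq (odd_sum p) (lam p).
Proof.
  intro Hp; apply (Series_correct (fun i => / INR (2 * i + 1) ^ p)).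
  apply (ex_series_le (V := R_CompleteNormedModule) _
           (fun i => / INR (2 * i + 1) ^ 2)); [|eexists; apply is_series_odd_2].
  intro i; change (Rabs (/ INR (2 * i + 1) ^ p) <= / INR (2 * i + 1) ^ 2).
  rewrite Rabs_pos_eq by apply Rlt_le, odd_term_pos.
  apply Rinv_le_contravar; [apply (pow_lt _ 2), lt_0_INR; lia|].
  apply (Rle_pow _ 2 p); [|assumption].
  apply (le_INR 1); lia.
Qed.

(** * Harmonic numbers and the telescoping sum of [1 / (t^2 - s^2)] *)

Fixpoint harmonic (n : nat) : R :=
  match n with O => 0 | S p => harmonic p + / INR (S p) end.

Lemma harmonic_sum (n : nat) : harmonic (S n) = sum_n (fun r => / INR (S r)) n.
Proof.
  induction n as [|n IH]; [rewrite sum_O; simpl; apply Rplus_0_l|].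
  rewrite sum_Sn, <- IH; reflexivity.
Qed.

Lemma harmonic_increment (n d : nat) :
  0 <= harmonic (n + d) - harmonic n <= INR d / INR (S n).
Proof.
  assert (Hn : 0 < INR (S n)) by (apply lt_0_INR; lia).
  induction d as [|d IH].
  - rewrite Nat.add_0_r; simpl (INR 0); unfold Rdiv; lra.
  - rewrite Nat.add_succ_r; cbn [harmonic].
    assert (H : 0 < / INR (S (n + d)) <= / INR (S n)).
    { split; [apply Rinv_0_lt_compat, lt_0_INR; lia|].
      apply Rinv_le_contravar; [assumption | apply le_INR; lia]. }
    rewrite (S_INR d).
    replace ((INR d + 1) / INR (S n)) with (INR d / INR (S n) + / INR (S n))
      by (field; lra).
    lra.
Qed.

(** A Cesaro mean of [1/n], which tends to [0]. *)
Lemma harmonic_div_lim : is_lim_seq (fun n => harmonic (S n) / INR (S n)) 0.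
Proof.
  apply (is_lim_seq_incr_1 (fun n => harmonic n / INR n)).
  apply is_lim_seq_Reals.
  assert (H : Un_cv (fun n => / INR (S n)) 0).
  { apply is_lim_seq_Reals, (is_lim_seq_incr_1 (fun n => / INR n)).
    apply (is_lim_seq_inv _ p_infty); [apply is_lim_seq_INR | discriminate]. }
  apply Cesaro_1 in H.
  apply is_lim_seq_Reals, is_lim_seq_incr_1; apply is_lim_seq_Reals, is_lim_seq_incr_1 in H.
  revert H; apply is_lim_seq_ext; intro n.
  rewrite harmonic_sum, sum_n_Reals; reflexivity.
Qed.

(** The value [0] on the diagonal removes the term [t = s] while sums still run over full ranges,
    and keeps antisymmetry. *)
Definition odd_inv_diff (i j : nat) : R :=
  if Nat.eq_dec i j then 0 else / (INR (2 * j + 1) ^ 2 - INR (2 * i + 1) ^ 2).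

Lemma odd_sqr_diff (i j : nat) :
  INR (2 * j + 1) ^ 2 - INR (2 * i + 1) ^ 2
  = 4 * (INR j - INR i) * (INR j + INR i + 1).
Proof. rewrite !plus_INR, !INR_double; simpl; ring. Qed.

Lemma odd_inv_diff_antisym (i j : nat) : odd_inv_diff j i = - odd_inv_diff i j.
Proof.
  unfold odd_inv_diff.
  destruct (Nat.eq_dec i j) as [Hij|Hij], (Nat.eq_dec j i); try congruence; [ring|].
  rewrite <- Rinv_opp; f_equal; ring.
Qed.

Lemma odd_inv_diff_split (i j : nat) : i <> j ->
  odd_inv_diff i j
  = / (4 * INR (2 * i + 1)) * (/ (INR j - INR i) - / (INR j + INR i + 1)).
Proof.
  intro Hij; unfold odd_inv_diff; destruct (Nat.eq_dec i j); [contradiction|].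
  rewrite odd_sqr_diff, plus_INR, INR_double; simpl (INR 1).
  pose proof (pos_INR i); pose proof (pos_INR j).
  assert (INR j <> INR i) by (intro E; apply INR_eq in E; congruence).
  field; repeat split; lra.
Qed.

(** For [j <= J] the numbers [i - j] and [i + j + 1] together fill the block [i - J .. i + J + 1],
    so the partial fractions add up to a difference of harmonic numbers. *)
Lemma odd_inv_diff_sum_low (i J : nat) : (J < i)%nat ->
  sum_n (odd_inv_diff i) J
  = - / (4 * INR (2 * i + 1)) * (harmonic (i + S J) - harmonic (i - S J)).
Proof.
  assert (Hi : INR (2 * i + 1) <> 0) by (apply not_0_INR; lia).
  assert (Hstep : forall J, (J < i)%nat -> odd_inv_diff i J
    = - / (4 * INR (2 * i + 1)) * (/ INR (S (i + J)) + / INR (i - J))).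
  { intros K HK; rewrite odd_inv_diff_split by lia.
    rewrite S_INR, (plus_INR i K), minus_INR by lia.
    assert (INR K < INR i) by (apply lt_INR; lia).
    pose proof (pos_INR K); field; repeat split; lra. }
  induction J as [|J IH]; intro HJ.
  - rewrite sum_O, Hstep, (Nat.add_1_r i), (Nat.add_0_r i), (Nat.sub_0_r i) by lia.
    destruct i as [|p]; [lia|].
    replace (S p - 1)%nat with p by lia; cbn [harmonic]; real_ring.
  - rewrite sum_Sn, IH, Hstep, (Nat.add_succ_r i (S J)) by lia; cbn [harmonic].
    replace (i - S J)%nat with (S (i - S (S J))) by lia; cbn [harmonic].
    real_ring.
Qed.

(** At [e = 0] the terms below the diagonal reach only [harmonic (2 * i)]; completing it to
    [harmonic (2 * i + 1)] produces [1 / (4 * s^2)] with [s = 2 * i + 1]. The remaining harmonic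
    difference tends to [0] as [e] grows. *)
Lemma odd_inv_diff_sum (i e : nat) :
  sum_n (odd_inv_diff i) (i + e)
  = / (4 * INR (2 * i + 1) ^ 2)
    - / (4 * INR (2 * i + 1)) * (harmonic (e + (2 * i + 1)) - harmonic e).
Proof.
  assert (Hi : INR (2 * i + 1) <> 0) by (apply not_0_INR; lia).
  assert (Hii : odd_inv_diff i i = 0)
    by (unfold odd_inv_diff; destruct (Nat.eq_dec i i); [reflexivity | contradiction]).
  induction e as [|e IH].
  - rewrite Nat.add_0_r, Nat.add_0_l.
    transitivity (- / (4 * INR (2 * i + 1)) * harmonic (2 * i)).
    + destruct i as [|i]; [rewrite sum_O, Hii; simpl; ring|].
      rewrite sum_Sn, Hii, odd_inv_diff_sum_low, Nat.sub_diag by lia.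
      replace (S i + S i)%nat with (2 * S i)%nat by lia.
      simpl (harmonic 0); real_ring.
    + rewrite Nat.add_1_r in *; cbn [harmonic]; real_eq; field; assumption.
  - rewrite (Nat.add_succ_r i e), sum_Sn, IH, odd_inv_diff_split by lia.
    rewrite Nat.add_succ_l; cbn [harmonic].
    replace (INR (S (i + e)) - INR i) with (INR (S e))
      by (rewrite !S_INR, plus_INR; ring).
    replace (INR (S (i + e)) + INR i + 1) with (INR (S (e + (2 * i + 1))))
      by (rewrite !S_INR, !plus_INR, INR_double; simpl; ring).
    real_ring.
Qed.

(** * Products of odd sums *)

Lemma sum_power_product (x y : R) (m : nat) :
  (x - y) * sum_n_m (fun k => x ^ k * y ^ (m - k + 1)) 1 m = x * y * (x ^ m - y ^ m).
Proof.
  induction m as [|m IH].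
  - rewrite sum_n_m_zero by lia; change (@zero R_AbelianMonoid) with 0; simpl; ring.
  - rewrite sum_n_Sm, Nat.sub_diag by lia.
    rewrite (sum_n_m_ext_loc _ (fun k => y * (x ^ k * y ^ (m - k + 1)))).
    2:{ intros k Hk; replace (S m - k)%nat with (S (m - k)) by lia; simpl; real_eq; ring. }
    rewrite sum_n_m_Rmult_l.
    change (@plus R_AbelianMonoid) with Rplus; rewrite Rmult_plus_distr_l.
    transitivity (y * (x * y * (x ^ m - y ^ m)) + (x - y) * (x ^ S m * y)).
    + rewrite <- IH; simpl; ring.
    + simpl; ring.
Qed.

Lemma sum_prod (u v : nat -> R) (M N : nat) :
  sum_n u M * sum_n v N = sum_n (fun i => sum_n (fun j => u i * v j) N) M.
Proof.
  rewrite <- (sum_n_mult_r (K := R_Ring)); apply sum_n_ext; intro i.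
  rewrite <- sum_n_Rmult_l; reflexivity.
Qed.

(** With [x = 1/s^2] and [y = 1/t^2], [x - y = x y (t^2 - s^2)]: this cancels the factor [x y] of
    the geometric sum and leaves the kernel [1 / (t^2 - s^2)]. On the diagonal all [m] terms are
    equal. *)
Lemma odd_power_product (m i j : nat) :
  sum_n_m (fun k => / INR (2 * i + 1) ^ (2 * k) * / INR (2 * j + 1) ^ (2 * (m - k + 1))) 1 m
  = (if Nat.eq_dec i j then INR m * / INR (2 * i + 1) ^ (2 * (m + 1)) else 0)
    + (/ INR (2 * i + 1) ^ (2 * m) - / INR (2 * j + 1) ^ (2 * m)) * odd_inv_diff i j.
Proof.
  assert (Hpos : forall l, 0 < INR (2 * l + 1)) by (intro l; apply lt_0_INR; lia).
  pose proof (Hpos i) as Hi; pose proof (Hpos j) as Hj.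
  unfold odd_inv_diff; destruct (Nat.eq_dec i j) as [<-|Hij].
  - rewrite (sum_n_m_ext_loc _ (fun _ => / INR (2 * i + 1) ^ (2 * (m + 1)))).
    + rewrite sum_n_m_const; replace (S m - 1)%nat with m by lia; real_ring.
    + intros k Hk; rewrite <- Rinv_mult, <- pow_add; do 2 f_equal; lia.
  - set (x := / INR (2 * i + 1) ^ 2); set (y := / INR (2 * j + 1) ^ 2).
    assert (Hx : forall k, / INR (2 * i + 1) ^ (2 * k) = x ^ k)
      by (intro k; unfold x; rewrite pow_mult, pow_inv; reflexivity).
    assert (Hy : forall k, / INR (2 * j + 1) ^ (2 * k) = y ^ k)
      by (intro k; unfold y; rewrite pow_mult, pow_inv; reflexivity).
    rewrite (sum_n_m_ext _ (fun k => x ^ k * y ^ (m - k + 1)))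
      by (intro k; rewrite Hx, Hy; reflexivity).
    assert (Hd : INR (2 * j + 1) ^ 2 - INR (2 * i + 1) ^ 2 <> 0).
    { rewrite odd_sqr_diff; pose proof (pos_INR i); pose proof (pos_INR j).
      assert (INR j <> INR i) by (intro E; apply INR_eq in E; congruence).
      intro E; apply Rmult_integral in E; lra. }
    assert (Hxy : x - y = x * y * (INR (2 * j + 1) ^ 2 - INR (2 * i + 1) ^ 2))
      by (unfold x, y; field; lra).
    assert (x * y <> 0).
    { apply Rgt_not_eq, Rmult_lt_0_compat; apply Rinv_0_lt_compat, pow_lt; assumption. }
    pose proof (sum_power_product x y m) as HS; rewrite Hxy in HS.
    rewrite !Hx, Hy, Rplus_0_l.
    apply (Rmult_eq_reg_l (x * y * (INR (2 * j + 1) ^ 2 - INR (2 * i + 1) ^ 2))).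
    + rewrite HS; field; assumption.
    + apply Rmult_integral_contrapositive; split; assumption.
Qed.

Lemma sum_n_m_Rswap (u : nat -> nat -> R) (p q N : nat) :
  sum_n_m (fun k => sum_n (fun i => u k i) N) p q
  = sum_n (fun i => sum_n_m (fun k => u k i) p q) N.
Proof.
  induction N as [|N IH].
  - rewrite sum_O; apply sum_n_m_ext; intro k; apply sum_O.
  - rewrite sum_Sn, <- IH.
    rewrite <- (sum_n_m_plus (G := R_AbelianMonoid)).
    apply sum_n_m_ext; intro k; apply sum_Sn.
Qed.

Lemma sum_n_diag (u : nat -> R) (i N : nat) : (i <= N)%nat ->
  sum_n (fun j => if Nat.eq_dec i j then u j else 0) N = u i.
Proof.
  assert (Hlt : forall M, (M < i)%nat ->
            sum_n (fun j => if Nat.eq_dec i j then u j else 0) M = 0).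
  { intros M HM; rewrite (sum_n_ext_loc _ (fun _ => 0)).
    - rewrite sum_n_const; apply Rmult_0_r.
    - intros j Hj; destruct (Nat.eq_dec i j); [lia | reflexivity]. }
  induction N as [|N IH]; intro Hi.
  - replace i with O by lia; rewrite sum_O; destruct (Nat.eq_dec 0 0);
      [reflexivity | contradiction].
  - rewrite sum_Sn; destruct (Nat.eq_dec i (S N)) as [->|Hne].
    + rewrite Hlt by lia; apply Rplus_0_l.
    + rewrite IH by lia; apply Rplus_0_r.
Qed.

(** The truncation error: the harmonic parts of [odd_inv_diff_sum] at [e = N - i], weighted by
    [1 / s^(2m)] with [s = 2 * i + 1]. *)
Definition odd_tail (m N : nat) : R :=
  sum_n (fun i => / INR (2 * i + 1) ^ (2 * m) * / (4 * INR (2 * i + 1))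
           * (harmonic (N - i + (2 * i + 1)) - harmonic (N - i))) N.

(** The diagonal contributes [m]. By antisymmetry the two halves of [(x i - x j) * odd_inv_diff i j]
    have equal sums, each contributing [1/4]; hence [m + 1/2]. *)
Lemma odd_sum_products (m N : nat) :
  sum_n_m (fun k => odd_sum (2 * k) N * odd_sum (2 * (m - k + 1)) N) 1 m
  = (INR m + 1 / 2) * odd_sum (2 * (m + 1)) N - 2 * odd_tail m N.
Proof.
  set (x := fun i => / INR (2 * i + 1) ^ (2 * m)).
  set (S1 := sum_n (fun i => x i * sum_n (odd_inv_diff i) N) N).
  assert (H1 : S1 = 1 / 4 * odd_sum (2 * (m + 1)) N - odd_tail m N).
  { transitivity (1 / 4 * odd_sum (2 * (m + 1)) N + -1 * odd_tail m N); [|real_ring].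
    unfold S1, odd_sum, odd_tail.
    rewrite <- !sum_n_Rmult_l, <- sum_n_Rplus.
    apply sum_n_ext_loc; intros i Hi; unfold x.
    replace N with (i + (N - i))%nat at 1 by lia.
    rewrite odd_inv_diff_sum.
    replace (2 * (m + 1))%nat with (2 * m + 2)%nat by lia; rewrite pow_add.
    assert (INR (2 * i + 1) <> 0) by (apply not_0_INR; lia).
    real_eq; field; split; [assumption | apply pow_nonzero; assumption]. }
  assert (H2 : sum_n (fun i => sum_n (fun j => (x i - x j) * odd_inv_diff i j) N) N
               = 2 * S1).
  { transitivity (S1 + sum_n (fun i => sum_n (fun j => x j * odd_inv_diff j i) N) N).
    - unfold S1; rewrite <- sum_n_Rplus; apply sum_n_ext; intro i.
      rewrite <- sum_n_Rmult_l, <- sum_n_Rplus; apply sum_n_ext; intro j.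
      rewrite (odd_inv_diff_antisym i j); real_eq; ring.
    - rewrite sum_n_switch, (sum_n_ext _ (fun i => x i * sum_n (odd_inv_diff i) N))
        by (intro i; apply sum_n_Rmult_l).
      fold S1; real_ring. }
  transitivity (INR m * odd_sum (2 * (m + 1)) N + 2 * S1); [|rewrite H1; real_eq; field].
  rewrite <- H2; unfold odd_sum at 3; rewrite <- sum_n_Rmult_l, <- sum_n_Rplus.
  unfold odd_sum.
  rewrite (sum_n_m_ext _ (fun k => sum_n (fun i => sum_n (fun j =>
     / INR (2 * i + 1) ^ (2 * k) * / INR (2 * j + 1) ^ (2 * (m - k + 1))) N) N))
    by (intro k; apply sum_prod).
  rewrite sum_n_m_Rswap; apply sum_n_ext_loc; intros i Hi.
  rewrite sum_n_m_Rswap, (sum_n_ext _ _ N (fun j => odd_power_product m i j)).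
  rewrite sum_n_Rplus; f_equal.
  exact (sum_n_diag (fun _ => INR m * / INR (2 * i + 1) ^ (2 * (m + 1))) i N Hi).
Qed.

(** With [t = 2 * i + 1], the harmonic difference is at most [t / (N - i + 1)] and
    [1 / t^(2m) <= 1 / (i + 1)]. The remaining [1 / ((i + 1) (N - i + 1))] is split by partial
    fractions, with [N + 2] weakened to [N + 1], and sums to harmonic numbers. *)
Lemma odd_tail_bounds (m N : nat) : (1 <= m)%nat ->
  0 <= odd_tail m N <= harmonic (S N) / INR (S N).
Proof.
  intro hm.
  assert (HN : 0 < INR (S N)) by (apply lt_0_INR; lia).
  assert (Hterm : forall i, (i <= N)%nat ->
    0 <= / INR (2 * i + 1) ^ (2 * m) * / (4 * INR (2 * i + 1))
           * (harmonic (N - i + (2 * i + 1)) - harmonic (N - i))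
      <= 1 / 4 * / INR (S N) * (/ INR (S i) + / INR (S (N - i)))).
  { intros i Hi.
    set (t := INR (2 * i + 1)).
    assert (Ht : 1 <= t) by (apply (le_INR 1); lia).
    pose proof (harmonic_increment (N - i) (2 * i + 1)) as Hh; fold t in Hh.
    assert (H0 : 0 < / t ^ (2 * m)) by (apply Rinv_0_lt_compat, pow_lt; lra).
    assert (HSi : 0 < INR (S i)) by (apply lt_0_INR; lia).
    assert (HSn : 0 < INR (S (N - i))) by (apply lt_0_INR; lia).
    assert (H1 : / t ^ (2 * m) <= / INR (S i)).
    { apply Rinv_le_contravar; [assumption|].
      apply (Rle_trans _ (t ^ 1)); [|apply Rle_pow; [assumption | lia]].
      rewrite pow_1; apply le_INR; lia. }
    assert (H4 : 0 < / (4 * t)) by (apply Rinv_0_lt_compat; lra).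
    split.
    - apply Rmult_le_pos; [|lra]; apply Rmult_le_pos; lra.
    - apply (Rle_trans _ (/ INR (S i) * / (4 * t) * (t / INR (S (N - i))))).
      + apply Rmult_le_compat; try lra; [apply Rmult_le_pos; lra|].
        apply Rmult_le_compat_r; lra.
      + replace (/ INR (S i) * / (4 * t) * (t / INR (S (N - i))))
          with (1 / 4 * / (INR (S i) * INR (S (N - i)))) by (field; lra).
        replace (1 / 4 * / INR (S N) * (/ INR (S i) + / INR (S (N - i))))
          with (1 / 4 * ((INR (S i) + INR (S (N - i))) / INR (S N)
                         * / (INR (S i) * INR (S (N - i))))) by (field; lra).
        apply Rmult_le_compat_l; [lra|].
        rewrite <- (Rmult_1_l (/ (INR (S i) * INR (S (N - i))))) at 1.
        apply Rmult_le_compat_r.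
        * apply Rlt_le, Rinv_0_lt_compat, Rmult_lt_0_compat; assumption.
        * apply (Rmult_le_reg_r (INR (S N))); [assumption|].
          unfold Rdiv; rewrite Rmult_assoc, Rinv_l, Rmult_1_l, Rmult_1_r by lra.
          rewrite <- plus_INR; apply le_INR; lia. }
  split.
  - unfold odd_tail; replace 0 with (sum_n (fun _ => 0) N)
      by (rewrite sum_n_const; apply Rmult_0_r).
    rewrite !sum_n_Reals; apply sum_Rle; intros i Hi; apply Hterm; assumption.
  - apply (Rle_trans _ (1 / 2 * (harmonic (S N) / INR (S N)))).
    + replace (1 / 2 * (harmonic (S N) / INR (S N))) with
        (sum_n (fun i => 1 / 4 * / INR (S N) * (/ INR (S i) + / INR (S (N - i)))) N).
      * unfold odd_tail; rewrite !sum_n_Reals; apply sum_Rle; intros i Hi.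
        apply Hterm; assumption.
      * rewrite sum_n_Rmult_l, sum_n_Rplus.
        rewrite (sum_n_rev (fun i => / INR (S i))), <- harmonic_sum; real_eq; field; lra.
    + assert (0 <= harmonic (S N) / INR (S N)).
      { pose proof (harmonic_increment 0 (S N)) as Hh; rewrite Nat.add_0_l in Hh.
        change (harmonic 0) with 0 in Hh; apply Rmult_le_pos; [lra|].
        apply Rlt_le, Rinv_0_lt_compat; assumption. }
      lra.
Qed.

Lemma is_lim_seq_sum_n_m (u : nat -> nat -> R) (l : nat -> R) (p q : nat) :
  (forall k, (p <= k <= q)%nat -> is_lim_seq (u k) (l k)) ->
  is_lim_seq (fun N => sum_n_m (fun k => u k N) p q) (sum_n_m l p q).
Proof.
  intro H; destruct (Nat.lt_ge_cases q p) as [Hqp|Hpq].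
  - rewrite sum_n_m_zero by assumption.
    apply (is_lim_seq_ext (fun _ => 0)); [|apply is_lim_seq_const].
    intro N; symmetry; exact (sum_n_m_zero _ p q Hqp).
  - induction Hpq as [|q Hpq IH].
    + rewrite sum_n_n; apply (is_lim_seq_ext (u p)); [|apply H; lia].
      intro N; symmetry; exact (sum_n_n (fun k => u k N) p).
    + rewrite sum_n_Sm by lia.
      apply (is_lim_seq_ext (fun N => sum_n_m (fun k => u k N) p q + u (S q) N)).
      * intro N; symmetry; apply (sum_n_Sm (fun k => u k N)); lia.
      * apply is_lim_seq_plus'; [apply IH; intros k Hk|]; apply H; lia.
Qed.

Lemma lam_recursion (m : nat) : (1 <= m)%nat ->
  sum_n_m (fun k => lam (2 * k) * lam (2 * (m - k + 1))) 1 m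
  = (INR m + 1 / 2) * lam (2 * (m + 1)).
Proof.
  intro hm.
  assert (H1 : is_lim_seq
    (fun N => sum_n_m (fun k => odd_sum (2 * k) N * odd_sum (2 * (m - k + 1)) N) 1 m)
    (sum_n_m (fun k => lam (2 * k) * lam (2 * (m - k + 1))) 1 m)).
  { apply is_lim_seq_sum_n_m; intros k Hk.
    apply is_lim_seq_mult'; apply is_lim_odd_sum; lia. }
  assert (H2 : is_lim_seq
    (fun N => (INR m + 1 / 2) * odd_sum (2 * (m + 1)) N - 2 * odd_tail m N)
    ((INR m + 1 / 2) * lam (2 * (m + 1)) - 2 * 0)).
  { apply is_lim_seq_minus'.
    - apply (is_lim_seq_scal_l _ _ (lam (2 * (m + 1)))), is_lim_odd_sum; lia.
    - apply (is_lim_seq_scal_l _ _ 0).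
      apply (is_lim_seq_le_le (fun _ => 0) _ (fun N => harmonic (S N) / INR (S N)));
        [intro N; apply odd_tail_bounds; assumption | apply is_lim_seq_const |
         apply harmonic_div_lim]. }
  apply (is_lim_seq_ext _ _ _ (odd_sum_products m)) in H1.
  apply is_lim_seq_unique in H1; apply is_lim_seq_unique in H2.
  rewrite H1 in H2; apply (f_equal real) in H2; cbn [real] in H2.
  etransitivity; [exact H2 | real_ring].
Qed.

(** * From odd sums to zeta values *)

Lemma zeta_lam (m : nat) : (1 <= m)%nat ->
  (1 - / 2 ^ (2 * m)) * zeta (INR (2 * m)) = lam (2 * m).
Proof.
  intro hm.
  set (z := fun i => / INR (S i) ^ (2 * m)).
  assert (Hz : zeta (INR (2 * m)) = Series z).
  { apply Series_ext; intro i; unfold z.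
    rewrite Rpower_pow by (apply lt_0_INR; lia); unfold Rdiv; ring. }
  assert (Hex : is_lim_seq (sum_n z) (Series z)).
  { apply (Series_correct z).
    (* The factor [4] comes from [i + 1 >= (2 * i + 1) / 2]. *)
    apply (ex_series_le (V := R_CompleteNormedModule) _
             (fun i => 4 * / INR (2 * i + 1) ^ 2)).
    - intro i; change (Rabs (z i) <= 4 * / INR (2 * i + 1) ^ 2); unfold z.
      assert (H1 : 1 <= INR (S i)) by (apply (le_INR 1); lia).
      assert (H2 : 0 < INR (2 * i + 1)) by (apply lt_0_INR; lia).
      rewrite Rabs_pos_eq by (apply Rlt_le, Rinv_0_lt_compat, pow_lt; lra).
      replace (4 * / INR (2 * i + 1) ^ 2) with (/ (INR (2 * i + 1) / 2) ^ 2)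
        by (field; lra).
      apply Rinv_le_contravar; [apply pow_lt; lra|].
      apply (Rle_trans _ (INR (S i) ^ 2)); [|apply Rle_pow; [assumption | lia]].
      apply pow_incr; rewrite plus_INR, INR_double, (S_INR i); simpl (INR 1); split; [|lra].
      pose proof (pos_INR i); lra.
    - exists (4 * (PI ^ 2 / 8)).
      exact (is_series_scal_l (K := R_AbsRing) 4 _ _ is_series_odd_2). }
  rewrite Hz.
  (* The denominators [1 .. 2N + 2] split into odd ones and doubles of [1 .. N + 1]. *)
  assert (Hsplit : forall N, sum_n z (2 * N + 1)
                     = odd_sum (2 * m) N + / 2 ^ (2 * m) * sum_n z N).
  { assert (Heven : forall N, z (2 * N + 1)%nat = / 2 ^ (2 * m) * z N).
    { intro N; unfold z; replace (S (2 * N + 1)) with (2 * S N)%nat by lia.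
      rewrite INR_double, Rpow_mult_distr, Rinv_mult; reflexivity. }
    induction N as [|N IH].
    - simpl (2 * 0 + 1)%nat; unfold odd_sum; rewrite sum_Sn, !sum_O.
      rewrite <- (Heven O); simpl; reflexivity.
    - replace (2 * S N + 1)%nat with (S (S (2 * N + 1))) at 1 by lia.
      rewrite !sum_Sn, IH, odd_sum_S.
      replace (S (S (2 * N + 1))) with (2 * S N + 1)%nat by lia.
      rewrite Heven; unfold z at 2.
      replace (S (S (2 * N + 1))) with (2 * S N + 1)%nat by lia.
      real_ring. }
  assert (H1 : is_lim_seq (fun N => sum_n z (2 * N + 1)) (Series z)).
  { apply (is_lim_seq_subseq (sum_n z)); [|assumption].
    apply eventually_subseq; intro n; lia. }
  apply (is_lim_seq_ext _ _ _ Hsplit) in H1.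
  assert (H2 : is_lim_seq (fun N => odd_sum (2 * m) N + / 2 ^ (2 * m) * sum_n z N)
                 (lam (2 * m) + / 2 ^ (2 * m) * Series z)).
  { apply is_lim_seq_plus'; [apply is_lim_odd_sum; lia|].
    apply (is_lim_seq_scal_l _ _ (Series z)); assumption. }
  apply is_lim_seq_unique in H1; apply is_lim_seq_unique in H2.
  rewrite H1 in H2; apply (f_equal real) in H2; cbn [real] in H2; lra.
Qed.

Lemma pow2_gt_1 (m : nat) : (1 <= m)%nat -> 1 < 2 ^ (2 * m).
Proof. intro hm; apply Rlt_pow_R1; [lra | lia]. Qed.

(** The normalization of [calZ] contains the factor [1 - 2^(-2m)] that turns zeta into [lam]. *)
Lemma calZ_lam (m : nat) : (1 <= m)%nat ->
  calZ m = (-1) ^ m * (2 * INR (fact (2 * m - 1)) / PI ^ (2 * m)) * lam (2 * m).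
Proof.
  intro hm; rewrite <- zeta_lam by assumption; unfold calZ.
  pose proof PI_RGT_0; pose proof (pow2_gt_1 m hm).
  assert (INR m <> 0) by (apply not_0_INR; lia).
  rewrite Rpow_mult_distr.
  replace (fact (2 * m)) with (2 * m * fact (2 * m - 1))%nat.
  - rewrite mult_INR, INR_double; field.
    repeat split; try apply pow_nonzero; lra.
  - replace (2 * m)%nat with (S (2 * m - 1)) at 1 3 by lia; reflexivity.
Qed.

Lemma lam_2 : lam 2 = PI ^ 2 / 8.
Proof. apply is_series_unique, is_series_odd_2. Qed.

(** Because [(2k - 1) + (2(m - k + 1) - 1) = 2m], the binomial coefficient cancels both factorials
    and every term has the same prefactor; then [4 * (2m)! * (m + 1/2) = 2 * (2m + 1)!]. *)
Lemma calZ_recursion (m : nat) : (1 <= m)%nat ->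
  calZ (m + 1) = sum_n_m (fun k =>
    Binomial.C (2 * m) (2 * k - 1) * calZ k * calZ (m - k + 1)) 1 m.
Proof.
  intro hm; pose proof PI_RGT_0 as HPI.
  rewrite (sum_n_m_ext_loc _ (fun k =>
    (-1) ^ (m + 1) * (4 * INR (fact (2 * m)) / PI ^ (2 * (m + 1)))
    * (lam (2 * k) * lam (2 * (m - k + 1))))).
  - rewrite sum_n_m_Rmult_l, lam_recursion, calZ_lam by lia.
    replace (2 * (m + 1) - 1)%nat with (S (2 * m)) by lia.
    rewrite fact_simpl, mult_INR, S_INR, INR_double; field.
    apply pow_nonzero; lra.
  - intros k Hk; rewrite !calZ_lam by lia; unfold Binomial.C.
    set (j := (m - k + 1)%nat).
    replace (2 * m - (2 * k - 1))%nat with (2 * j - 1)%nat by lia.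
    replace (m + 1)%nat with (k + j)%nat by lia.
    rewrite Nat.mul_add_distr_l, !pow_add.
    real_eq; field.
    repeat split; try apply pow_nonzero; try apply INR_fact_neq_0; lra.
Qed.

(** Both sides satisfy the same quadratic recursion, and both are [-1/4] at [m = 1]. *)
Lemma calZ_heuler (m : nat) : (1 <= m)%nat -> calZ m = 1 / 2 * heuler (2 * m - 1)%nat.
Proof.
  induction m as [m IH] using Wf_nat.lt_wf_ind; intro hm.
  destruct (Nat.eq_dec m 1) as [->|Hm].
  - rewrite calZ_lam by lia; replace (2 * 1 - 1)%nat with 1%nat by lia.
    change (2 * 1)%nat with 2%nat; rewrite lam_2, heuler_1.
    pose proof PI_RGT_0; simpl; field; lra.
  - replace m with (m - 1 + 1)%nat by lia; set (p := (m - 1)%nat).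
    rewrite calZ_recursion by lia.
    replace (2 * (p + 1) - 1)%nat with (2 * p + 1)%nat by lia.
    rewrite heuler_odd_recursion, <- !sum_n_m_Rmult_l by lia.
    apply sum_n_m_ext_loc; intros k Hk.
    rewrite !IH by lia.
    replace (2 * (p - k + 1) - 1)%nat with (2 * (p - k) + 1)%nat by lia.
    real_eq; field.
Qed.

(** * The four families as multiples of the odd coefficients of [heuler] *)

Lemma bernoulli_even (B : nat -> R) (m : nat) : is_bernoulli B -> (1 <= m)%nat ->
  (1 - 2 ^ (2 * m)) * B (2 * m)%nat = INR m * heuler (2 * m - 1)%nat.
Proof.
  intros HB hm; pose proof (bernoulli_heuler B (2 * m - 1) HB) as H.
  replace (S (2 * m - 1)) with (2 * m)%nat in H by lia.
  rewrite INR_double in H; lra.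
Qed.

Lemma calB_heuler (B : nat -> R) (m : nat) : is_bernoulli B -> (1 <= m)%nat ->
  calB B m = - (1 / 2) * heuler (2 * m - 1)%nat.
Proof.
  intros HB hm; unfold calB; rewrite INR_double.
  assert (Hm : INR m <> 0) by (apply not_0_INR; lia).
  transitivity (- / (2 * INR m) * ((1 - 2 ^ (2 * m)) * B (2 * m)%nat)); [field; assumption|].
  rewrite (bernoulli_even B m HB hm); field; assumption.
Qed.

Lemma genocchi_even (G : nat -> R) (m : nat) : is_genocchi G -> (1 <= m)%nat ->
  G (2 * m)%nat = 2 * INR m * heuler (2 * m - 1)%nat.
Proof.
  intros HG hm; rewrite <- INR_double; pose proof (genocchi_heuler G (2 * m - 1) HG) as H.
  replace (S (2 * m - 1)) with (2 * m)%nat in H by lia; exact H.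
Qed.

Lemma calG_heuler (G : nat -> R) (m : nat) : is_genocchi G -> (1 <= m)%nat ->
  calG G m = 2 * heuler (2 * m - 1)%nat.
Proof.
  intros HG hm; unfold calG; rewrite (genocchi_even G m HG hm).
  field; apply not_0_INR; lia.
Qed.

Lemma zeta_even (m : nat) : (1 <= m)%nat ->
  zeta (INR (2 * m))
  = (-1) ^ m * (PI ^ (2 * m) * INR m / (INR (fact (2 * m)) * (2 ^ (2 * m) - 1)))
    * (2 ^ (2 * m - 1) * heuler (2 * m - 1)%nat).
Proof.
  intro hm; pose proof (calZ_heuler m hm) as H; unfold calZ in H.
  pose proof PI_RGT_0; pose proof (pow2_gt_1 m hm).
  assert (Hm : INR m <> 0) by (apply not_0_INR; lia).
  pose proof (INR_fact_neq_0 (2 * m)).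
  replace (heuler (2 * m - 1)%nat) with (2 * (1 / 2 * heuler (2 * m - 1)%nat)) by field.
  rewrite <- H.
  transitivity ((-1) ^ m * (-1) ^ m * zeta (INR (2 * m))); [rewrite pow_opp1_sqr; ring|].
  rewrite Rpow_mult_distr.
  replace (2 ^ (2 * m)) with (2 * 2 ^ (2 * m - 1)) in *
    by (rewrite tech_pow_Rmult; f_equal; lia).
  field; repeat split; try apply pow_nonzero; lra.
Qed.

Theorem theorem1p4 (m : nat) (hm : (1 <= m)%nat) :
  (* (i) *)
  (forall B : nat -> R, is_bernoulli B ->
     B (2 * m)%nat
       = (-1) ^ (m - 1) * (INR m / (2 ^ (2 * m - 1) * (2 ^ (2 * m) - 1)))
         * Sigma m
     /\ B (2 * m)%nat
       = - (INR m / (2 ^ (2 * m - 1) * (2 ^ (2 * m) - 1))) * Lambda m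
     /\ calB B (m + 1)
       = - sum_n_m (fun k : nat =>
               Binomial.C (2 * m) (2 * k - 1) * calB B k * calB B (m - k + 1))
             1 m)
  (* (ii) *)
  /\ (zeta (INR (2 * m))
       = PI ^ (2 * m) * INR m / (INR (fact (2 * m)) * (2 ^ (2 * m) - 1))
         * Sigma m
     /\ zeta (INR (2 * m))
       = (-1) ^ m
         * (PI ^ (2 * m) * INR m / (INR (fact (2 * m)) * (2 ^ (2 * m) - 1)))
         * Lambda m
     /\ calZ (m + 1)
       = sum_n_m (fun k : nat =>
               Binomial.C (2 * m) (2 * k - 1) * calZ k * calZ (m - k + 1))
             1 m)
  (* (iii) *)
  /\ (forall G : nat -> R, is_genocchi G ->
     G (2 * m)%nat = (-1) ^ m * (INR m / 2 ^ (2 * (m - 1))) * Sigma m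
     /\ G (2 * m)%nat = INR (2 * m) / 2 ^ (2 * m - 1) * Lambda m
     /\ calG G (m + 1)
       = 1 / 4 * sum_n_m (fun k : nat =>
               Binomial.C (2 * m) (2 * k - 1) * calG G k * calG G (m - k + 1))
             1 m)
  (* (iv) *)
  /\ (forall E : nat -> R -> R, is_euler_polynomials E ->
     E (2 * m - 1)%nat 0 = (-1) ^ m * (1 / 2 ^ (2 * m - 1)) * Sigma m
     /\ E (2 * m - 1)%nat 0 = 1 / 2 ^ (2 * m - 1) * Lambda m
     /\ E (2 * m + 1)%nat 0
       = 1 / 2 * sum_n_m (fun k : nat =>
               Binomial.C (2 * m) (2 * k - 1)
               * E (2 * k - 1)%nat 0 * E (2 * (m - k) + 1)%nat 0)
             1 m).
Proof.
  pose proof (pow2_gt_1 m hm) as H2.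
  assert (Hp : 0 < 2 ^ (2 * m - 1)) by (apply pow_lt; lra).
  assert (Hm : 0 < INR m) by (apply lt_0_INR; lia).
  pose proof (pow_opp1_sqr m) as Hsq.
  assert (Hsq' : (-1) ^ (m - 1) * (-1) ^ m = -1).
  { rewrite pow_opp1_sub, pow_1, Rmult_assoc, (Rmult_comm (-1)), <- Rmult_assoc, Hsq by lia.
    ring. }
  assert (Hrec := heuler_odd_recursion m hm).
  repeat split.
  - rewrite Sigma_heuler by assumption.
    transitivity (- (INR m * heuler (2 * m - 1)%nat) / (2 ^ (2 * m) - 1)).
    + rewrite <- (bernoulli_even B m) by assumption; field; lra.
    + transitivity ((-1) ^ (m - 1) * (-1) ^ m
        * (INR m * heuler (2 * m - 1)%nat) / (2 ^ (2 * m) - 1)).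
      * rewrite Hsq'; field; lra.
      * field; lra.
  - rewrite Lambda_heuler by assumption.
    transitivity (- (INR m * heuler (2 * m - 1)%nat) / (2 ^ (2 * m) - 1)); [|field; lra].
    rewrite <- (bernoulli_even B m) by assumption; field; lra.
  - rewrite calB_heuler by (trivial; lia).
    replace (2 * (m + 1) - 1)%nat with (2 * m + 1)%nat by lia; rewrite Hrec.
    match goal with |- _ = - ?s => replace (- s) with (-1 * s) by ring end.
    rewrite <- !sum_n_m_Rmult_l; apply sum_n_m_ext_loc; intros k Hk.
    rewrite !calB_heuler by (trivial; lia).
    replace (2 * (m - k + 1) - 1)%nat with (2 * (m - k) + 1)%nat by lia.
    real_eq; field.
  - rewrite zeta_even, Sigma_heuler by assumption; ring.
  - rewrite zeta_even, Lambda_heuler by assumption; reflexivity.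
  - apply calZ_recursion; assumption.
  - rewrite genocchi_even, Sigma_heuler by assumption.
    transitivity ((-1) ^ m * (-1) ^ m * (2 * INR m * heuler (2 * m - 1)%nat));
      [rewrite Hsq; ring|].
    replace (2 ^ (2 * m - 1)) with (2 * 2 ^ (2 * (m - 1)))
      by (rewrite tech_pow_Rmult; f_equal; lia).
    field; apply pow_nonzero; lra.
  - rewrite genocchi_even, Lambda_heuler, INR_double by assumption; field; lra.
  - rewrite calG_heuler by (trivial; lia).
    replace (2 * (m + 1) - 1)%nat with (2 * m + 1)%nat by lia; rewrite Hrec.
    rewrite <- !sum_n_m_Rmult_l; apply sum_n_m_ext_loc; intros k Hk.
    rewrite !calG_heuler by (trivial; lia).
    replace (2 * (m - k + 1) - 1)%nat with (2 * (m - k) + 1)%nat by lia.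
    real_eq; field.
  - rewrite euler_heuler, Sigma_heuler by assumption.
    transitivity ((-1) ^ m * (-1) ^ m * heuler (2 * m - 1)%nat); [rewrite Hsq; ring|].
    field; lra.
  - rewrite euler_heuler, Lambda_heuler by assumption; field; lra.
  - rewrite euler_heuler, Hrec by assumption; f_equal.
    apply sum_n_m_ext_loc; intros k Hk; rewrite !euler_heuler by assumption; reflexivity.
Qed.
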